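(* Let $H,K,E$ be Hilbert $\mathfrak{A}$-modules over a $C^*$-algebra $\mathfrak{A}$, and let $A\in\mathcal{L}(H,K)$ and $B\in\mathcal{L}(H,E)$ be such that $A$ and $A^*A+B^*B$ are both M-P invertible. Then for all positive definite operators $V\in\mathcal{L}(K)$ and $W\in\mathcal{L}(E)$, and for every $U\in\Omega_{A,B,W}$, $$\lim_{t\to 0^+}\left(A^*VA+tB^*WB\right)^{\dag}A^*V=A^\dag_{VU}$$ in the operator-norm topology.
   Context: $\mathcal{L}(H,K)$ is the set of adjointable operators from $H$ to $K$, $\mathcal{L}(H)=\mathcal{L}(H,H)$; $\mathcal{R}(\cdot)$ and $\mathcal{N}(\cdot)$ denote range and null space. A positive definite operator on a Hilbert $\mathfrak{A}$-module $K$ is a positive operator in $\mathcal{L}(K)$ that is invertible in $\mathcal{L}(K)$. For positive definite $M\in\mathcal{L}(K)$, $N\in\mathcal{L}(H)$ and $A\in\mathcal{L}(H,K)$, the weighted Moore-Penrose inverse $A^\dag_{MN}$ (if it exists) is the unique $X\in\mathcal{L}(K,H)$ with $AXA=A$, $XAX=X$, $(MAX)^*=MAX$, $(NXA)^*=NXA$; $A^\dag=A^\dag_{I_KI_H}$ is the Moore-Penrose inverse, and $A$ is called M-P invertible if $A^\dag$ exists (equivalently, $\mathcal{R}(A)$ is closed). If $A$ is M-P invertible then $A^\dag_{MN}$ exists for all positive definite $M,N$. For $A\in\mathcal{L}(H,K)$, $B\in\mathcal{L}(H,E)$ with $A^*A+B^*B$ M-P invertible and $W\in\mathcal{L}(E)$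 positive definite, $\Omega_{A,B,W}$ is the set of operators $U\in\mathcal{L}(H)$ of the form $$U=A^*XA+B^*WB+YP_{\mathcal{N}(A)\cap\mathcal{N}(B)},$$ where $P_{\mathcal{N}(A)\cap\mathcal{N}(B)}$ is the (orthogonal) projection from $H$ onto $\mathcal{N}(A)\cap\mathcal{N}(B)$, $Y$ is an arbitrary positive definite operator on $\mathcal{N}(A)\cap\mathcal{N}(B)$, and $X\in\mathcal{L}(K)$ is an arbitrary self-adjoint operator such that $(A^*XA+B^*WB)|_{\mathcal{R}(A^*A+B^*B)}$ is a positive definite operator on $\mathcal{R}(A^*A+B^*B)$. (Every such $U$ is positive definite on $H$. If $\mathcal{N}(A)\cap\mathcal{N}(B)=\{0\}$, the last term is absent.) *)

(* Defs.v *)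
From HB Require Import structures.
From mathcomp Require Import all_boot all_order all_algebra.
From mathcomp Require Import complex.
From mathcomp Require Import all_classical all_reals all_analysis.

Set Implicit Arguments.
Unset Strict Implicit.
Unset Printing Implicit Defensive.

Import Order.TTheory GRing.Theory Num.Theory.
Import numFieldNormedType.Exports.

Local Open Scope classical_set_scope.
Local Open Scope ring_scope.

(* C*-algebras, not assumed to be unital (hence the multiplication is not the
   one of a MathComp ring).  The scalar field is meant to be R[i] with
   R : realType. *)
HB.mixin Record isCStarAlgebra (C : numClosedFieldType) T
    of CompleteNormedModule C T := {
  cmul : T -> T -> T;
  cstar : T -> T;
  cmulA : forall a b c, cmul a (cmul b c) = cmul (cmul a b) c;
  cmulDl : forall a b c, cmul (a + b) c = cmul a c + cmul b c;
  cmulDr : forall a b c, cmul a (b + c) = cmul a b + cmul a c;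
  cmulZl : forall (k : C) a b, cmul (k *: a) b = k *: cmul a b;
  cmulZr : forall (k : C) a b, cmul a (k *: b) = k *: cmul a b;
  cstarK : forall a, cstar (cstar a) = a;
  cstarD : forall a b, cstar (a + b) = cstar a + cstar b;
  cstarZ : forall (k : C) a, cstar (k *: a) = k^* *: cstar a;
  cstarM : forall a b, cstar (cmul a b) = cmul (cstar b) (cstar a);
  cnormM : forall a b, `|cmul a b| <= `|a| * `|b|;
  cnorm_starM : forall a, `|cmul (cstar a) a| = `|a| ^+ 2
}.

#[short(type="cstarAlgType")]
HB.structure Definition CStarAlgebra (C : numClosedFieldType) :=
  {T of isCStarAlgebra C T & CompleteNormedModule C T}.

Section Positivity.
Context {C : numClosedFieldType} {T : cstarAlgType C}.

Definition quasi_invertible (a : T) :=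
  exists b : T, a + b - cmul a b = 0 /\ a + b - cmul b a = 0.

(* A nonzero l is in the spectrum of a (computed in the unitization) iff
   1 - l^-1 a is not invertible there, iff l^-1 a is not quasi-invertible. *)
Definition nz_spectrum (a : T) : set C :=
  [set l | l != 0 /\ ~ quasi_invertible (l^-1 *: a)].

(* Self-adjoint with spectrum contained in [0, +oo[. *)
Definition cpositive (a : T) :=
  cstar a = a /\ (forall l, nz_spectrum a l -> 0 <= l).

End Positivity.

(* Right Hilbert modules; the inner product is linear in its second argument.
   By inner_norm the norm of the underlying complete normed module is the one
   induced by the inner product; it also gives definiteness. *)
HB.mixin Record isHilbertModule (C : numClosedFieldType) (AA : cstarAlgType C) T
    of CompleteNormedModule C T := {
  ract : T -> AA -> T;
  inner : T -> T -> AA;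
  ractDl : forall x y a, ract (x + y) a = ract x a + ract y a;
  ractDr : forall x a b, ract x (a + b) = ract x a + ract x b;
  ractM : forall x a b, ract x (cmul a b) = ract (ract x a) b;
  ractZl : forall (k : C) x a, ract (k *: x) a = k *: ract x a;
  ractZr : forall (k : C) x a, ract x (k *: a) = k *: ract x a;
  innerDr : forall x y z, inner x (y + z) = inner x y + inner x z;
  innerZr : forall (k : C) x y, inner x (k *: y) = k *: inner x y;
  inner_ract : forall x y a, inner x (ract y a) = cmul (inner x y) a;
  inner_star : forall x y, cstar (inner x y) = inner y x;
  inner_positive : forall x, cpositive (inner x x);
  inner_norm : forall x, `|x| ^+ 2 = `|inner x x|
}.

#[short(type="hilbertModType")]
HB.structure Definition HilbertModule (C : numClosedFieldType)
    (AA : cstarAlgType C) :=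
  {T of isHilbertModule C AA T & CompleteNormedModule C T}.

Section Inner.
Context {C : numClosedFieldType} {AA : cstarAlgType C} {H : hilbertModType AA}.
Implicit Types x y z : H.

Lemma innerDl x y z : inner (x + y) z = inner x z + inner y z :> AA.
Proof. by rewrite -inner_star innerDr cstarD !inner_star. Qed.

Lemma innerZl (k : C) x y : inner (k *: x) y = k^* *: inner x y :> AA.
Proof. by rewrite -inner_star innerZr cstarZ inner_star. Qed.

Lemma innerNr x y : inner x (- y) = - inner x y :> AA.
Proof. by rewrite -scaleN1r innerZr scaleN1r. Qed.

Lemma innerNl x y : inner (- x) y = - inner x y :> AA.
Proof. by rewrite -scaleN1r innerZl rmorphN1 scaleN1r. Qed.

Lemma inner0r x : inner x 0 = 0 :> AA.
Proof. by rewrite -(scale0r (0 : H)) innerZr scale0r. Qed.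

Lemma inner0l x : inner 0 x = 0 :> AA.
Proof. by rewrite -(scale0r (0 : H)) innerZl conjC0 scale0r. Qed.

Lemma inner_eq0 x : inner x x = 0 :> AA -> x = 0.
Proof.
move=> x0; apply/normr0_eq0/eqP; rewrite -sqrf_eq0.
by rewrite inner_norm x0 normr0.
Qed.

Lemma inner_inj x y :
  (forall z, inner z x = inner z y :> AA) -> x = y.
Proof.
move=> xy; apply/subr0_eq/inner_eq0.
by rewrite innerDr innerNr xy subrr.
Qed.

End Inner.

(* L(H, K): a map bundled with its adjoint.  By adjopP the adjoint carries no
   extra information. *)
Record adjop (C : numClosedFieldType) (AA : cstarAlgType C)
    (H K : hilbertModType AA) := AdjOp {
  adjop_fun :> H -> K;
  adjop_adj : K -> H;
  adjop_axiom : forall x y, inner (adjop_fun x) y = inner x (adjop_adj y) :> AA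
}.

Notation "''L' ( H , K )" := (adjop H K)
  (at level 8, format "''L' ( H ,  K )") : type_scope.

Section AdjOp.
Context {C : numClosedFieldType} {AA : cstarAlgType C}.
Implicit Types H K E F : hilbertModType AA.

Lemma adjopP H K (S T : 'L(H, K)) : S =1 T -> S = T.
Proof.
case: S T => [s s' sP] [t t' tP] /= /funext st; subst t.
have st' : s' = t'.
  by apply/funext => y; apply: inner_inj => x; rewrite -sP tP.
by subst t'; congr AdjOp; apply: Prop_irrelevance.
Qed.

Section Operations.
Context {H K : hilbertModType AA}.
Implicit Types S T : 'L(H, K).

HB.instance Definition _ := gen_eqMixin 'L(H, K).
HB.instance Definition _ := gen_choiceMixin 'L(H, K).

Fact zero_op_subproof (x : H) (y : K) : inner (0 : K) y = inner x (0 : H) :> AA.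
Proof. by rewrite inner0l inner0r. Qed.
Definition zero_op : 'L(H, K) := AdjOp zero_op_subproof.

Fact opp_op_subproof T x y :
  inner (- T x) y = inner x (- adjop_adj T y) :> AA.
Proof. by rewrite innerNl innerNr adjop_axiom. Qed.
Definition opp_op T : 'L(H, K) := AdjOp (opp_op_subproof T).

Fact add_op_subproof S T x y :
  inner (S x + T x) y = inner x (adjop_adj S y + adjop_adj T y) :> AA.
Proof. by rewrite innerDl innerDr !adjop_axiom. Qed.
Definition add_op S T : 'L(H, K) := AdjOp (add_op_subproof S T).

Fact scale_op_subproof (k : C) T x y :
  inner (k *: T x) y = inner x (k^* *: adjop_adj T y) :> AA.
Proof. by rewrite innerZl innerZr adjop_axiom. Qed.
Definition scale_op (k : C) T : 'L(H, K) := AdjOp (scale_op_subproof k T).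

Fact add_opA : associative add_op.
Proof. by move=> S T U; apply: adjopP => x /=; rewrite addrA. Qed.
Fact add_opC : commutative add_op.
Proof. by move=> S T; apply: adjopP => x /=; rewrite addrC. Qed.
Fact add_op0 : left_id zero_op add_op.
Proof. by move=> T; apply: adjopP => x /=; rewrite add0r. Qed.
Fact add_opN : left_inverse zero_op opp_op add_op.
Proof. by move=> T; apply: adjopP => x /=; rewrite addNr. Qed.

HB.instance Definition _ :=
  GRing.isZmodule.Build 'L(H, K) add_opA add_opC add_op0 add_opN.

Fact scale_opA a b T : scale_op a (scale_op b T) = scale_op (a * b) T.
Proof. by apply: adjopP => x /=; rewrite scalerA. Qed.
Fact scale_op1 : left_id 1 scale_op.
Proof. by move=> T; apply: adjopP => x /=; rewrite scale1r. Qed.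
Fact scale_opDr : right_distributive scale_op +%R.
Proof. by move=> a S T; apply: adjopP => x /=; rewrite scalerDr. Qed.
Fact scale_opDl T : {morph scale_op^~ T : a b / a + b}.
Proof. by move=> a b; apply: adjopP => x /=; rewrite scalerDl. Qed.

HB.instance Definition _ := GRing.Zmodule_isLmodule.Build C 'L(H, K)
  scale_opA scale_op1 scale_opDr scale_opDl.

Fact adj_op_subproof T x y : inner (adjop_adj T x) y = inner x (T y) :> AA.
Proof. by rewrite -inner_star -adjop_axiom inner_star. Qed.
Definition adj_op T : 'L(K, H) := AdjOp (adj_op_subproof T).

End Operations.

Fact comp_op_subproof H K E (S : 'L(K, E)) (T : 'L(H, K)) x y :
  inner (S (T x)) y = inner x (adjop_adj T (adjop_adj S y)) :> AA.
Proof. by rewrite !adjop_axiom. Qed.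
Definition comp_op H K E (S : 'L(K, E)) (T : 'L(H, K)) : 'L(H, E) :=
  AdjOp (comp_op_subproof S T).

End AdjOp.

Notation "T ^#" := (adj_op T) (at level 2, format "T ^#") : ring_scope.
Notation "S ** T" := (comp_op S T)
  (at level 40, left associativity, format "S  **  T") : ring_scope.

Section MoorePenrose.
Context {C : numClosedFieldType} {AA : cstarAlgType C}.
Implicit Types H K E : hilbertModType AA.

Definition kernel H K (A : 'L(H, K)) : set H := [set x | A x = 0].

Definition self_adjoint H (T : 'L(H, H)) := T^# = T.

(* T and T' restrict to mutually adjoint operators in L(D), for a (closed)
   submodule D; their values outside D are irrelevant. *)
Definition adjoint_on H (D : set H) (T T' : H -> H) :=
  [/\ forall x, D x -> D (T x),
      forall x, D x -> D (T' x) &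
      forall x y, D x -> D y -> inner (T x) y = inner x (T' y) :> AA].

(* The restriction of T to the submodule D is a positive element of L(D), in
   the sense that <x, T x> is positive in AA for all x in D, and it is
   invertible in L(D). *)
Definition posdef_on H (D : set H) (T : H -> H) :=
  [/\ exists T', adjoint_on D T T',
      forall x, D x -> cpositive (inner x (T x) : AA) &
      exists S, (exists S', adjoint_on D S S') /\
        (forall x, D x -> T (S x) = x /\ S (T x) = x)].

Definition posdef H (T : 'L(H, H)) := posdef_on [set: H] T.

Definition is_wmpinv H K (M : 'L(K, K)) (N : 'L(H, H)) (A : 'L(H, K))
    (X : 'L(K, H)) :=
  [/\ A ** X ** A = A, X ** A ** X = X,
      self_adjoint (M ** A ** X) & self_adjoint (N ** X ** A)].

Definition wmp_invertible H K (M : 'L(K, K)) (N : 'L(H, H)) (A : 'L(H, K)) :=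
  exists X, is_wmpinv M N A X.

(* 0 when there is no weighted Moore-Penrose inverse. *)
Definition wmpinv H K (M : 'L(K, K)) (N : 'L(H, H)) (A : 'L(H, K)) : 'L(K, H) :=
  xget 0 (is_wmpinv M N A).

Fact id_op_subproof H (x y : H) : inner (id x) y = inner x (id y) :> AA.
Proof. by []. Qed.
Definition id_op H : 'L(H, H) := AdjOp (@id_op_subproof H).

Definition mp_invertible H K (A : 'L(H, K)) :=
  wmp_invertible (id_op K) (id_op H) A.

Definition mpinv H K (A : 'L(H, K)) : 'L(K, H) :=
  wmpinv (id_op K) (id_op H) A.

Definition is_projection H (D : set H) (P : 'L(H, H)) :=
  [/\ P ** P = P, self_adjoint P & range P = D].

Definition Omega H K E (A : 'L(H, K)) (B : 'L(H, E)) (W : 'L(E, E)) :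
    set 'L(H, H) :=
  [set U | exists (X : 'L(K, K)) (Y : H -> H) (P : 'L(H, H)),
    [/\ self_adjoint X,
        posdef_on (range (A^# ** A + B^# ** B))
          (A^# ** X ** A + B^# ** W ** B),
        posdef_on (kernel A `&` kernel B) Y,
        is_projection (kernel A `&` kernel B) P &
        forall x, U x = (A^# ** X ** A + B^# ** W ** B) x + Y (P x)]].

End MoorePenrose.

(* The norms of H and K are R[i]-valued, but real. *)
Definition opnorm (R : realType) (AA : cstarAlgType R[i])
    (H K : hilbertModType AA) (T : 'L(H, K)) : \bar R :=
  ereal_sup [set (complex.Re `|T x|)%:E | x in [set x : H | `|x| <= 1]].

(* Main.v *)
Require Import Defs.
From mathcomp Require Import all_boot all_order all_algebra.
From mathcomp Require Import complex lra.
From mathcomp Require Import all_classical all_reals all_analysis.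
Import Order.TTheory GRing.Theory Num.Theory.
Import numFieldNormedType.Exports.
Local Open Scope classical_set_scope.
Local Open Scope ring_scope.

(**
With V positive definite, A^# V A + t B^# W B has a null space N(A) `&` N(B)
that does not depend on t > 0, so its Moore-Penrose inverse Z satisfies
Z (A^# V A) x + t Z (B^# W B) x = x for all x orthogonal to that null space.
Put X = A^+_{VU}, e = X A and b = B^# W B.  The choice of U makes e^# b = b e.
Evaluating the identity at x = J y, where J = X V^-1 X^#, gives
Z e^# = J - t Z e^# b J, which bounds Z e^# uniformly for small t; evaluating it
at x = X y gives Z A^# V - X = - t Z e^# b X, which is therefore O(t).

The existence of the inverses rests on one fact about the order of the
C*-algebra: the norm is monotone on positive elements.  It makes positive
invertible forms coercive, and coercive ones invertible by a continuity method.
It is obtained from square roots of self-adjoint multiplication operators and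
the norm identity |(r + i w) v|^2 = |v^* (r^2 + w^2) v| for commuting
self-adjoint r and w.
*)

Set Implicit Arguments.
Unset Strict Implicit.
Unset Printing Implicit Defensive.

(** * Real-valued norms and geometric sequences *)

Section RealNorm.
Context {R : realType} {V : normedModType R[i]}.
Implicit Types (x y : V) (c : R).

Definition rn x : R := complex.Re `|x|.

Lemma rnE x : `|x| = (rn x)%:C%C.
Proof. by rewrite RRe_real // normr_real. Qed.

Lemma rn_ge0 x : 0 <= rn x.
Proof. by rewrite -ler0c -rnE. Qed.

Lemma rn0 : rn (0 : V) = 0.
Proof. by rewrite /rn normr0. Qed.

Lemma rn_eq0 x : rn x = 0 -> x = 0.
Proof. by move=> h; apply/normr0_eq0; rewrite rnE h. Qed.

Lemma rnN x : rn (- x) = rn x.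
Proof. by rewrite /rn normrN. Qed.

Lemma rn_sub x y : rn (x - y) = rn (y - x).
Proof. by rewrite -rnN opprB. Qed.

Lemma rnD x y : rn (x + y) <= rn x + rn y.
Proof. by rewrite -lecR rmorphD /= -!rnE ler_normD. Qed.

Lemma rnB x y : rn (x - y) <= rn x + rn y.
Proof. by rewrite -(rnN y) rnD. Qed.

Lemma rn_tri x y z : rn (x - z) <= rn (x - y) + rn (y - z).
Proof. by apply: le_trans (rnD _ _); rewrite addrA subrK. Qed.

Lemma rnZ (k : R[i]) x : rn (k *: x) = complex.Re `|k| * rn x.
Proof.
by apply: complexI; rewrite -rnE normrZ rmorphM /= -rnE; congr (_ * _).
Qed.

Lemma rnZr c x : rn (c%:C%C *: x) = `|c| * rn x.
Proof. by rewrite rnZ normc_def /= expr0n addr0 sqrtr_sqr. Qed.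

Lemma rnZp c x : 0 <= c -> rn (c%:C%C *: x) = c * rn x.
Proof. by move=> c0; rewrite rnZr ger0_norm. Qed.

Lemma rn_le0 x : rn x <= 0 -> x = 0.
Proof. by move=> h; apply/rn_eq0/le_anti; rewrite h rn_ge0. Qed.

End RealNorm.

Lemma geometric_small {R : realType} (M q e : R) : 0 <= q < 1 -> 0 < e ->
  exists n, M * q ^+ n < e.
Proof.
move=> /andP[q0 q1] e0.
have : (fun n => M * q ^+ n) @ \oo --> M * 0.
  by apply: cvgM; [exact: cvg_cst | apply: cvg_expr; rewrite ger0_norm].
rewrite mulr0 => /cvgrPdist_lt /(_ _ e0) [n _ /(_ n (leqnn n))].
by rewrite sub0r normrN => /(le_lt_trans (ler_norm _)) ?; exists n.
Qed.

(** * Complete spaces: geometric convergence and contractions *)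

Section Complete.
Context {R : realType} {V : completeNormedModType R[i]}.

(** Bounding the increments by differences of [M * q ^+ n] lets the estimates telescope, so no
    geometric series has to be summed. *)
Lemma geometric_cvg (u : nat -> V) (M q : R) : 0 <= q < 1 ->
  (forall n, rn (u n.+1 - u n) <= M * (q ^+ n - q ^+ n.+1)) ->
  exists l, forall n, rn (l - u n) <= M * q ^+ n.
Proof.
move=> q01 hu; have /andP[q0 q1] := q01.
have uk n k : rn (u (n + k)%N - u n) <= M * (q ^+ n - q ^+ (n + k)).
  elim: k => [|k IH]; first by rewrite addn0 !subrr mulr0 rn0.
  rewrite addnS; apply: le_trans (rn_tri _ (u (n + k)%N) _) _.
  by have := hu (n + k)%N; move: IH; lra.
have M0 : 0 <= M.
  have := le_trans (rn_ge0 _) (hu 0); rewrite expr0 expr1.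
  by rewrite pmulr_lge0 // subr_gt0.
have um n m : (n <= m)%N -> rn (u m - u n) <= M * q ^+ n.
  move=> /subnKC <-; apply: le_trans (uk _ _) _.
  by rewrite ler_wpM2l // gerBl exprn_ge0.
have : cauchy (u @ \oo).
  apply/cauchyP => e e0; have er : e = (complex.Re e)%:C%C.
    by rewrite RRe_real // gtr0_real.
  have [n hn] := @geometric_small R M q (complex.Re e) q01 ltac:(by rewrite -ltcR -er).
  exists (u n); exists n => // m /= nm.
  rewrite -ball_normE /= er rnE ltcR rn_sub.
  by apply: le_lt_trans (um _ _ nm) _.
move=> /cauchy_cvg cu; exists (lim (u @ \oo)) => n.
rewrite leNgt; apply/negP => h.
pose d := rn (lim (u @ \oo) - u n) - M * q ^+ n.
have d0 : (0 : R[i]) < d%:C%C by rewrite ltcR subr_gt0.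
move: cu => /cvgrPdist_lt /(_ _ d0) [m _ /(_ (m + n)%N (leq_addr _ _))].
rewrite rnE ltcR; have := um n (m + n)%N (leq_addl _ _).
have := rn_tri (lim (u @ \oo)) (u (m + n)%N) (u n).
by rewrite /d; lra.
Qed.

Lemma contraction_fixpoint (f : V -> V) (q : R) : 0 <= q < 1 ->
  (forall x y, rn (f x - f y) <= q * rn (x - y)) -> exists x, f x = x.
Proof.
move=> q01 hf; have /andP[q0 q1] := q01.
(* [M] solves [M * (1 - q) = rn (f 0)], the bound on the first increment. *)
pose u n := iter n f 0; pose M := rn (f 0) / (1 - q).
have [|l hl] := @geometric_cvg u M q q01.
  elim=> [|n IH].
    by rewrite /u /= subr0 expr0 expr1 /M divfK // subr_eq0 gt_eqF.
  apply: le_trans (hf _ _) _; apply: le_trans (ler_wpM2l q0 IH) _.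
  by rewrite -/(iter n.+1 f 0) !exprS; lra.
exists l; apply/subr0_eq/rn_le0; rewrite leNgt; apply/negP => h.
have [n hn] := @geometric_small R (2 * M) q _ q01 h.
have := rn_tri (f l) (u n.+1) l; have := hf l (u n); have := hl n.
have := ler_wpM2r (rn_ge0 (l - u n)) (ltW q1).
have := hl n.+1; rewrite [rn (l - _)]rn_sub exprS.
have : M * (q * q ^+ n) <= M * q ^+ n.
  rewrite ler_wpM2l ?ler_piMl ?exprn_ge0 ?(ltW q1) //.
  by rewrite divr_ge0 ?rn_ge0 // subr_ge0 ltW.
by rewrite /= mul1r; lra.
Qed.

End Complete.

(** * Self-adjoint multiplication operators on a C*-algebra *)

Section HermitianOperators.
Context {R : realType} {AA : cstarAlgType R[i]}.
Implicit Types (a b u v : AA) (f g r w x : AA -> AA) (c k q : R).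

Local Notation "c *r v" := (c%:C%C *: v) (at level 40).

Lemma cmulNl a b : cmul (- a) b = - cmul a b.
Proof. by rewrite -scaleN1r cmulZl scaleN1r. Qed.

Lemma cmulNr a b : cmul a (- b) = - cmul a b.
Proof. by rewrite -scaleN1r cmulZr scaleN1r. Qed.

Lemma cmulBl a b u : cmul (a - b) u = cmul a u - cmul b u.
Proof. by rewrite cmulDl cmulNl. Qed.

Lemma cmulBr a b u : cmul u (a - b) = cmul u a - cmul u b.
Proof. by rewrite cmulDr cmulNr. Qed.

Lemma cstarN a : cstar (- a) = - cstar a.
Proof. by rewrite -scaleN1r cstarZ rmorphN1 scaleN1r. Qed.

Lemma cstarB a b : cstar (a - b) = cstar a - cstar b.
Proof. by rewrite cstarD cstarN. Qed.

Lemma cstarZr c a : cstar (c *r a) = c *r cstar a.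
Proof. by rewrite cstarZ conj_Creal //; apply/complex_realP; exists c. Qed.

Lemma rn_cmul a b : rn (cmul a b) <= rn a * rn b.
Proof. by rewrite -lecR rmorphM /= -!rnE cnormM. Qed.

Lemma rn_starM a : rn (cmul (cstar a) a) = rn a ^+ 2.
Proof. by apply: complexI; rewrite rmorphXn /= -!rnE cnorm_starM. Qed.

Lemma rn_star a : rn (cstar a) = rn a.
Proof.
have le b : rn b <= rn (cstar b).
  have := rn_cmul (cstar b) b; rewrite rn_starM expr2.
  have := rn_ge0 b; rewrite le_eqVlt => /orP[/eqP<- _|b0]; first exact: rn_ge0.
  by rewrite ler_pM2r.
by apply/le_anti; rewrite le andbT -{2}[a]cstarK le.
Qed.

(** At [b := u - v] the C*-identity gives [rn (u - v) ^+ 2 = 0]. This nondegeneracy stands in for a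
    unit. *)
Lemma starM_inj u v :
  (forall b, cmul (cstar b) u = cmul (cstar b) v) -> u = v.
Proof.
move=> uv; apply/subr0_eq/rn_eq0/eqP; rewrite -sqrf_eq0 -rn_starM.
by rewrite cmulBr uv subrr rn0.
Qed.

(* f is its own adjoint for the AA-valued inner product u^* v of AA; this forces
   linearity, because the product of AA is nondegenerate. *)
Definition sa f := forall u v, cmul (cstar (f u)) v = cmul (cstar u) (f v).

Definition bnd f k := forall v, rn (f v) <= k * rn v.

(** Bounded self-adjoint operators on [AA], seen as a Hilbert module over itself. Working with them
    supplies the identity operator even when [AA] has no unit. *)
Definition hop f := sa f /\ exists2 k, 0 <= k & bnd f k.

Lemma saD f u v : sa f -> f (u + v) = f u + f v.
Proof.
by move=> fs; apply: starM_inj => b; rewrite cmulDr -!fs cmulDr.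
Qed.

Lemma saZ f (l : R[i]) u : sa f -> f (l *: u) = l *: f u.
Proof.
by move=> fs; apply: starM_inj => b; rewrite cmulZr -!fs cmulZr.
Qed.

Lemma saB f u v : sa f -> f (u - v) = f u - f v.
Proof.
by move=> fs; apply: starM_inj => b; rewrite cmulBr -!fs cmulBr.
Qed.

Lemma hop_scaleD f c k : hop f -> hop (fun v => c *r f v + k *r v).
Proof.
move=> [fs [n n0 fn]]; split.
  by move=> u v; rewrite cstarD !cstarZr cmulDl cmulDr !cmulZl !cmulZr fs.
exists (`|c| * n + `|k|); first by rewrite addr_ge0 ?mulr_ge0.
move=> v; apply: le_trans (rnD _ _) _; rewrite !rnZr mulrDl -mulrA.
by rewrite lerD2r ler_wpM2l.
Qed.

Lemma hop_comp f g : hop f -> hop g -> (forall v, f (g v) = g (f v)) ->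
  hop (fun v => f (g v)).
Proof.
move=> [fs [n n0 fn]] [gs [k k0 gk]] fg; split.
  by move=> u v; rewrite fs gs fg.
exists (n * k); first exact: mulr_ge0.
by move=> v; apply: le_trans (fn _) _; rewrite -mulrA ler_wpM2l.
Qed.

Lemma hop_cmul a : cstar a = a -> hop (cmul a).
Proof.
move=> aa; split; first by move=> u v; rewrite cstarM aa cmulA.
by exists (rn a); [exact: rn_ge0|move=> v; exact: rn_cmul].
Qed.

(* The two combinations r v +- i w v have norm sqrt(e) * |v|. *)
Lemma sum_sqr_bound r w e v : 0 <= e -> sa r -> sa w ->
  (forall v, r (w v) = w (r v)) -> (forall v, r (r v) + w (w v) = e *r v) ->
  rn (r v) ^+ 2 <= e * rn v ^+ 2.
Proof.
move=> e0 rs ws rw rwe.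
(* Meant for [l] equal to ['i] or [- 'i]. The cross terms cancel because [r] and [w] commute, which
   leaves the product of [cstar v] with [r (r v) + w (w v)]. *)
have main (l : R[i]) : l^* = - l -> l * l = - 1 ->
    rn (r v + l *: w v) ^+ 2 = e * rn v ^+ 2.
  move=> lc ll; rewrite -!rn_starM -rnZp // -cmulZr -rwe.
  rewrite cstarD cstarZ lc cmulDl !cmulDr !cmulZl !cmulZr scalerA mulNr ll opprK.
  by rewrite !rs !ws rw scale1r scaleNr -addrA addNKr.
have h1 := main 'i (@conjCi _) (@mulCii _).
have h2 : rn (r v - 'i *: w v) ^+ 2 = e * rn v ^+ 2.
  by rewrite -scaleNr; apply: main; rewrite ?mulrNN ?mulCii // rmorphN /= conjCi.
rewrite -h1; apply: lerXn2r; rewrite ?nnegrE ?rn_ge0 //.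
have : rn (2%:R *r r v) <= rn (r v + 'i *: w v) + rn (r v - 'i *: w v).
  apply: le_trans (rnD _ _); rewrite addrACA subrr addr0.
  by rewrite rmorphD /= scalerDl scale1r.
have -> : rn (r v - 'i *: w v) = rn (r v + 'i *: w v).
  by apply/eqP; rewrite -(eqrXn2 (ltn0Sn 1)) ?rn_ge0 // h1 h2.
by rewrite rnZp ?ler0n //; lra.
Qed.

End HermitianOperators.

(** * Square roots of positive self-adjoint operators *)

Section SquareRoot.
Context {R : realType} {AA : cstarAlgType R[i]}.
Implicit Types (a b u v : AA) (f g r w x : AA -> AA) (c k q : R).

Local Notation "c *r v" := (c%:C%C *: v) (at level 40).

Lemma geometric_eq0 (V : normedModType R[i]) (a : V) (M q : R) : 0 <= q < 1 ->
  (forall n, rn a <= M * q ^+ n) -> a = 0.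
Proof.
move=> q01 h; apply/rn_le0; rewrite leNgt; apply/negP => a0.
by have [n] := geometric_small M q01 a0; rewrite ltNge h.
Qed.

(* 1 - w is the fixed point of y |-> (x + y^2) / 2, a contraction near 0. *)
Lemma sqrt_contraction x q : sa x -> bnd x q -> 0 <= q < 1 ->
  exists w, [/\ hop w, forall v, w (w v) = v - x v &
    forall g, hop g -> (forall v, g (x v) = x (g v)) ->
    forall v, g (w v) = w (g v)].
Proof.
move=> xs xq q01; have /andP[q0 q1] := q01.
pose step f v := 2^-1 *r (x v + f (f v)).
pose y n := iter n step (fun=> 0).
have half0 : (0 : R) <= 2^-1 by rewrite invr_ge0.
have yS n v : y n.+1 v = 2^-1 *r (x v + y n (y n v)) by [].
have yh n : sa (y n) /\ bnd (y n) q.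
  elim: n => [|n [ys yq]].
    split=> [u v|v]; last by rewrite /y /= rn0 mulr_ge0 ?rn_ge0.
    by rewrite /y /= -(subrr (0 : AA)) cstarB cmulBl cmulBr !subrr.
  split=> [u v|v].
    by rewrite !yS cstarZr cmulZl cmulZr cstarD cmulDl cmulDr xs !ys.
  rewrite yS rnZp //; have := rnD (x v) (y n (y n v)); have := xq v.
  have := yq (y n v); have := ler_wpM2l q0 (yq v); have := rn_ge0 v.
  have : q * (q * rn v) <= q * rn v.
    by rewrite ler_piMl ?mulr_ge0 ?rn_ge0 // ltW.
  by lra.
(* The iterates are polynomials in [x]; in particular they commute with one another. *)
have yc g : hop g -> (forall v, g (x v) = x (g v)) ->
    forall n v, g (y n v) = y n (g v).
  move=> [gs _] gx; elim=> [|n IH] v.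
    by rewrite /y /= -(subrr (0 : AA)) saB // !subrr.
  by rewrite !yS saZ // saD // gx !IH.
have xh : hop x by split=> //; exists q.
have yh' n : hop (y n) by have [? ?] := yh n; split=> //; exists q.
have xy n v : x (y n v) = y n (x v) by exact: yc.
have yy n m v : y n (y m v) = y m (y n v) by exact: yc.
(* By commutation the difference of two consecutive squares is [y n.+1 d + y n d], [d] being the
   previous increment. Both operators have bound [q], so half of this is at most [q * rn d]. *)
have yd n v : rn (y n.+1 v - y n v) <= q * q ^+ n * rn v.
  elim: n v => [|n IH] v.
    rewrite yS /y /= subr0 addr0 rnZp // expr0 mulr1.
    by have := xq v; have := rn_ge0 (x v); lra.
  rewrite [y n.+2 v]yS [y n.+1 v in X in _ - X]yS -scalerBr opprD addrACA subrr add0r.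
  set d := y n.+1 v - y n v.
  have -> : y n.+1 (y n.+1 v) - y n (y n v) = y n.+1 d + y n d.
    rewrite /d (saB _ _ (yh n.+1).1) (saB _ _ (yh n).1).
    by rewrite (yy n n.+1) addrA subrK.
  rewrite rnZp //; have := rnD (y n.+1 d) (y n d).
  have [[_ /(_ d) h1] [_ /(_ d) h2]] := (yh n.+1, yh n).
  have := ler_wpM2l q0 (IH v); rewrite -/d exprS; lra.
have /boolp.choice[Y Yy] : forall v, exists l, forall n,
    rn (l - y n v) <= q / (1 - q) * rn v * q ^+ n.
  move=> v.
  apply: (@geometric_cvg R AA (fun n => y n v)) => // n; apply: le_trans (yd n v) _.
  have : q / (1 - q) * (1 - q) = q by rewrite divfK // subr_eq0 gt_eqF.
  rewrite exprS; set z := q / _ => zq; rewrite -{1}zq; lra.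
pose M := q / (1 - q).
have M0 : 0 <= M by rewrite divr_ge0 // subr_ge0 ltW.
have Ys : sa Y.
  move=> u v; apply/subr0_eq; apply: (@geometric_eq0 _ _ (2 * M * rn u * rn v) q q01) => n.
  have -> : cmul (cstar (Y u)) v - cmul (cstar u) (Y v) =
      cmul (cstar (Y u - y n u)) v - cmul (cstar u) (Y v - y n v).
    rewrite cstarB cmulBl cmulBr; have [-> _] := yh n.
    by rewrite opprB addrA subrK.
  apply: le_trans (rnB _ _) _.
  have := rn_cmul (cstar (Y u - y n u)) v; have := rn_cmul (cstar u) (Y v - y n v).
  rewrite !rn_star; have := ler_wpM2r (rn_ge0 v) (Yy u n); have := ler_wpM2l (rn_ge0 u) (Yy v n).
  rewrite -/M; lra.
have Yb : bnd Y (M + q).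
  move=> v; have := Yy v 0%N; rewrite expr0 mulr1 /y /= subr0 -/M.
  have := mulr_ge0 q0 (rn_ge0 v); lra.
have Yh : hop Y by split=> //; exists (M + q); rewrite ?addr_ge0.
(* The fixed point equation, doubled: it says that the square of [1 - Y] is [1 - x]. *)
have Yfix v : Y v + Y v = x v + Y (Y v).
  apply/subr0_eq.
  apply: (@geometric_eq0 _ _ (4 * (M * rn v) + M * rn (Y v)) q q01) => n.
  have -> : Y v + Y v - (x v + Y (Y v)) =
     2 *r (Y v - y n.+1 v) - y n (Y v - y n v) - (Y (Y v) - y n (Y v)).
    rewrite scalerBr yS scalerA -rmorphM divff ?rmorph1 ?scale1r //=.
    rewrite rmorphD /= scalerDl scale1r saB; last by case: (yh n).
    rewrite !opprD !opprK !addrA.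
    set C := y n (y n v); set D := Y (Y v); set G := y n (Y v).
    by rewrite [_ - G + C]addrAC subrK [_ - D + G]addrAC subrK.
  have h1 := Yy v n.+1; have h2 := Yy (Y v) n.
  have h3 := Yy v n; have [_ /(_ (Y v - y n v)) h4] := yh n.
  apply: le_trans (rnB _ _) _; have := rnB (2 *r (Y v - y n.+1 v)) (y n (Y v - y n v)).
  rewrite rnZp //; have qn : q ^+ n.+1 <= q ^+ n by rewrite exprS ler_piMl ?exprn_ge0 // ltW.
  have := ler_wpM2l (mulr_ge0 M0 (rn_ge0 v)) qn.
  have : q * rn (Y v - y n v) <= rn (Y v - y n v) by rewrite ler_piMl ?rn_ge0 // ltW.
  have := mulr_ge0 (mulr_ge0 M0 (rn_ge0 v)) (exprn_ge0 n q0).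
  by move: h1 h2 h3 h4; rewrite -/M; lra.
exists (fun v => v - Y v); split.
- have := hop_scaleD (- 1) 1 Yh; congr hop; apply/funext => v.
  by rewrite rmorphN1 scaleN1r scale1r addrC.
- move=> v; have -> : x v = Y v + Y v - Y (Y v) by rewrite Yfix addrK.
  by rewrite saB // !opprB -addrA; congr (_ + _); rewrite addrCA opprD.
- move=> g gh gx v; have [gs [k k0 gk]] := gh; rewrite saB //; congr (_ - _).
  apply/subr0_eq; apply: (@geometric_eq0 _ _ (k * (M * rn v) + M * rn (g v)) q q01) => n.
  have -> : g (Y v) - Y (g v) = g (Y v - y n v) - (Y (g v) - y n (g v)).
    by rewrite saB // yc // opprB addrA subrK.
  apply: le_trans (rnB _ _) _; have := gk (Y v - y n v); have := Yy (g v) n.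
  have := ler_wpM2l k0 (Yy v n); rewrite -/M; lra.
Qed.

(** Write [f + e] as [(c + e) (1 - x)] with [x = (c - f) / (c + e)]. The shift gives [x] the bound
    [c / (c + e) < 1], as [sqrt_contraction] requires. *)
Lemma sqrt_shift f c e : hop f -> 0 <= c -> bnd (fun v => c *r v - f v) c -> 0 < e ->
  exists r, [/\ hop r, forall v, r (r v) = f v + e *r v &
    forall g, hop g -> (forall v, g (f v) = f (g v)) ->
    forall v, g (r v) = r (g v)].
Proof.
move=> fh c0 fc e0; have ce0 : 0 < c + e by rewrite ltr_wpDl.
pose x v := (c + e)^-1 *r (c *r v - f v).
have hx : hop x.
  have := hop_scaleD (- (c + e)^-1) ((c + e)^-1 * c) fh.
  congr hop; apply/funext => v.
  by rewrite /x scalerBr scalerA -rmorphM rmorphN scaleNr addrC.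
have q01 : 0 <= c / (c + e) < 1.
  by rewrite divr_ge0 ?(ltW ce0) //= ltr_pdivrMr // mul1r ltrDl.
have [|w [wh ww wc]] := @sqrt_contraction x (c / (c + e)) hx.1 _ q01.
  move=> v; rewrite rnZp ?invr_ge0 ?(ltW ce0) // mulrAC mulrC.
  by rewrite ler_wpM2r ?invr_ge0 ?(ltW ce0).
pose s := Num.sqrt (c + e).
exists (fun v => s *r w v); split.
- have := hop_scaleD s 0 wh; congr hop; apply/funext => v.
  by rewrite scale0r addr0.
- move=> v; rewrite (saZ _ _ wh.1) scalerA -rmorphM -expr2 sqr_sqrtr ?ltW // ww /x.
  rewrite (scalerBr _ v) scalerA -rmorphM divff ?gt_eqF // rmorph1 scale1r.
  by rewrite rmorphD /= scalerDl opprB addrCA [_ + e *r v]addrC addrK addrC.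
- move=> g gh gf v; rewrite (saZ _ _ gh.1) wc // => u; rewrite /x.
  by rewrite (saZ _ _ gh.1) (saB _ _ gh.1) (saZ _ _ gh.1) gf.
Qed.

End SquareRoot.

(** * Order and norm for positive operators *)

Section PositiveOperators.
Context {R : realType} {AA : cstarAlgType R[i]}.
Implicit Types (a b u v : AA) (f g r w x j : AA -> AA) (c k q e : R).

Local Notation "c *r v" := (c%:C%C *: v) (at level 40).

(* For a self-adjoint f this says that the spectrum of f lies in [0, 2 c]. *)
Definition pos f := exists2 c : R, 0 <= c & bnd (fun v => c *r v - f v) c.

(** Removes the shift introduced by [sqrt_shift]. Restricting to [e <= 1] lets terms quadratic in
    [e] be absorbed into [e * z]. *)
Lemma le_eps (s t z : R) : (forall e, 0 < e <= 1 -> s <= t + e * z) -> s <= t.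
Proof.
move=> h; rewrite leNgt; apply/negP => st.
pose e := Num.min 1 ((s - t) / (2 * (`|z| + 1))).
have d0 : 0 < 2 * (`|z| + 1) by rewrite mulr_gt0 // ltr_wpDl.
have e0 : 0 < e by rewrite lt_min ltr01 /= divr_gt0 // subr_gt0.
have /h : 0 < e <= 1 by rewrite e0 ge_min lexx.
have : e * (2 * (`|z| + 1)) <= s - t by rewrite -ler_pdivlMr // ge_min lexx orbT.
have := ler_wpM2l (ltW e0) (ler_norm z); have : 0 <= e * `|z| by rewrite mulr_ge0 // ltW.
by lra.
Qed.

Lemma sum_sqr_bound2 r w e v : 0 <= e -> sa r -> sa w ->
  (forall v, r (w v) = w (r v)) -> (forall v, r (r v) + w (w v) = e *r v) ->
  rn (r (r v)) <= e * rn v.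
Proof.
move=> e0 rs ws rw rwe.
have h1 := sum_sqr_bound v e0 rs ws rw rwe.
have h2 := sum_sqr_bound (r v) e0 rs ws rw rwe.
rewrite -(@ler_pXn2r _ 2) ?nnegrE ?mulr_ge0 ?rn_ge0 //.
by apply: le_trans h2 _; rewrite exprMn expr2 -mulrA ler_wpM2l.
Qed.

Lemma hop_sub c f : hop f -> hop (fun v => c *r v - f v).
Proof.
move=> fh; have := hop_scaleD (- 1) c fh; congr hop; apply/funext => v.
by rewrite rmorphN1 scaleN1r addrC.
Qed.

(** Square roots [r] of [f + t] and [w] of [e - f + t] commute, and their squares add up to
    [e + 2 * t]; so [sum_sqr_bound2] bounds the square of [r], which is [f + t]. *)
Lemma pos_bnd f e : hop f -> pos f -> 0 <= e -> pos (fun v => e *r v - f v) ->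
  bnd f e.
Proof.
move=> fh [c c0 fc] e0 [d d0 fd] v; apply: (@le_eps _ _ (3 * rn v)) => t /andP[t0 _].
have [r [rh rr rc]] := sqrt_shift fh c0 fc t0.
have [w [wh ww wc]] := sqrt_shift (hop_sub e fh) d0 fd t0.
have rf u : r (f u) = f (r u) by rewrite rc.
have rw u : r (w u) = w (r u).
  by apply: wc => // u'; rewrite (saB _ _ rh.1) (saZ _ _ rh.1) rf.
have et0 : 0 <= e + 2 * t by rewrite addr_ge0 // mulr_ge0 // ltW.
have h : rn (r (r v)) <= (e + 2 * t) * rn v.
  apply: (sum_sqr_bound2 v et0 rh.1 wh.1 rw) => u.
  rewrite rr ww addrACA [f u + _]addrC subrK -!scalerDl -!rmorphD.
  by congr (_%:C%C *: _); lra.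
have -> : f v = r (r v) - t *r v by rewrite rr addrK.
apply: le_trans (rnB _ _) _; rewrite rnZp ?(ltW t0) //; move: h; lra.
Qed.

(** Squares are positive: if [w] is a square root of [k - f f + t], the squares of [w] and [f] add
    up to [k + t], which bounds the square of [w]. *)
Lemma bnd_sqr_compl f k : hop f -> 0 <= k -> bnd (fun v => f (f v)) k ->
  bnd (fun v => k *r v - f (f v)) k.
Proof.
move=> fh k0 fk v; apply: (@le_eps _ _ (2 * rn v)) => t /andP[t0 _].
have ffh : hop (fun v => f (f v)) by exact: hop_comp.
have [|w [wh ww wc]] := @sqrt_shift _ _ _ k t (hop_sub k ffh) k0 _ t0.
  by move=> u; rewrite subKr.
have fw u : f (w u) = w (f u).
  by apply: wc => // u'; rewrite (saB _ _ fh.1) (saZ _ _ fh.1).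
have kt0 : 0 <= k + t by rewrite addr_ge0 // ltW.
have h : rn (w (w v)) <= (k + t) * rn v.
  apply: (sum_sqr_bound2 v kt0 wh.1 fh.1 (fun u => esym (fw u))) => u.
  by rewrite ww addrAC subrK rmorphD /= scalerDl.
have -> : k *r v - f (f v) = w (w v) - t *r v by rewrite ww addrK.
apply: le_trans (rnB _ _) _; rewrite rnZp ?(ltW t0) //; move: h; lra.
Qed.

(** With commuting square roots [r] of [f + t] and [s] of [g + t], the product [(f + t) (g + t)] is
    the square of [r s]; then [t] tends to 0. *)
Lemma pos_comp f g : hop f -> hop g -> (forall v, f (g v) = g (f v)) ->
  pos f -> pos g -> pos (fun v => f (g v)).
Proof.
move=> fh gh fg [c c0 fc] [d d0 gd].
have [_ [F F0 fF]] := fh; have [_ [G G0 gG]] := gh.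
exists (F * G); first exact: mulr_ge0.
move=> v; apply: (@le_eps _ _ (3 * (F + G + 1) * rn v)) => t /andP[t0 t1].
have [r [rh rr rc]] := sqrt_shift fh c0 fc t0.
have [s [sh ss sc]] := sqrt_shift gh d0 gd t0.
have rg u : r (g u) = g (r u) by rewrite rc // => ?; rewrite fg.
have rs u : r (s u) = s (r u) by exact: sc.
have uu u : r (s (r (s u))) = f (g u) + t *r (f u + g u + t *r u).
  rewrite -rs rr ss (saD _ _ fh.1) (saZ _ _ fh.1) -addrA; congr (_ + _).
  by rewrite !scalerDr addrA.
pose K := (F + t) * (G + t).
have K0 : 0 <= K by rewrite mulr_ge0 // addr_ge0 // ltW.
have sb u : rn (s (s u)) <= (G + t) * rn u.
  rewrite ss; apply: le_trans (rnD _ _) _; rewrite rnZp ?(ltW t0) //.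
  by have := gG u; lra.
have rb u : rn (r (r u)) <= (F + t) * rn u.
  rewrite rr; apply: le_trans (rnD _ _) _; rewrite rnZp ?(ltW t0) //.
  by have := fF u; lra.
have ub : bnd (fun u => r (s (r (s u)))) K.
  move=> u; rewrite -rs; apply: le_trans (rb _) _; rewrite /K -mulrA.
  by rewrite ler_wpM2l // addr_ge0 // ltW.
have := bnd_sqr_compl (hop_comp rh sh rs) K0 ub v.
rewrite uu => h.
(* The error is at most [3 * t * (F + G + 1) * rn v]: twice from [K - F * G] and once from the term
   [t *r (f v + g v + t *r v)]. *)
have -> : (F * G) *r v - f (g v) = K *r v - (f (g v) + t *r (f v + g v + t *r v))
    + (t *r (f v + g v + t *r v) - (K - F * G) *r v).
  rewrite rmorphB /= scalerBl; set S := t *r _; set k := K *r v; set m := f (g v).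
  by rewrite opprD opprB !addrA subrK [k - m + _]addrAC [in RHS]addrAC [k + _]addrC addrK.
apply: le_trans (rnD _ _) _.
have := rnB (t *r (f v + g v + t *r v)) ((K - F * G) *r v).
have := rnD (f v + g v) (t *r v); have := rnD (f v) (g v).
have KFG : 0 <= K - F * G.
  have := mulr_ge0 F0 (ltW t0); have := mulr_ge0 G0 (ltW t0).
  have := mulr_ge0 (ltW t0) (ltW t0); rewrite /K; lra.
rewrite !rnZp ?(ltW t0) // => h1 h2.
have h3 : rn (f v + g v + t *r v) <= (F + G + 1) * rn v.
  apply: le_trans h2 _; have := fF v; have := gG v.
  by have := ler_wpM2r (rn_ge0 v) t1; move: h1; lra.
have := ler_wpM2l (ltW t0) h3.
have : (K - F * G) <= t * (F + G + 1).
  have := ler_wpM2l (ltW t0) t1; rewrite /K; lra.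
move=> /(ler_wpM2r (rn_ge0 v)); move: h; lra.
Qed.

(* With j = (g - x)^-1, positivity of (M - j) (g - x) = M (g - x) - 1 says that
   x <= g - 1 / M. *)
Lemma bnd_improve x j (g M : R) : hop x -> pos x -> 0 < M -> 0 <= g - M^-1 -> bnd x g ->
  bnd j M -> (forall v, g *r j v - x (j v) = v) ->
  (forall v, j (g *r v - x v) = v) -> bnd x (g - M^-1).
Proof.
move=> xh xp M0 gM xg jM kj jk.
have g0 : 0 <= g by rewrite (le_trans gM) // gerBl invr_ge0 ltW.
have kh := hop_sub g xh.
have js : sa j.
  by move=> u v; rewrite -{1}[v]kj -(kh.1 (j u) (j v)) kj.
have jh : hop j by split=> //; exists M => //; exact: ltW.
have jx v : j (x v) = x (j v).
  have : j (g *r v - x v) = g *r j v - x (j v) by rewrite jk kj.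
  by rewrite (saB _ _ js) (saZ _ _ js) => /addrI/oppr_inj.
have Mjh := hop_sub M jh.
have Mjp : pos (fun v => M *r v - j v).
  by exists M; [exact: ltW | move=> v; rewrite subKr].
have kp : pos (fun v => g *r v - x v).
  by exists g => // v; rewrite subKr.
have [|c c0 hc] := pos_comp Mjh kh _ Mjp kp.
  move=> v; have -> : x (M *r v - j v) = M *r x v - (g *r j v - v).
    rewrite (saB _ _ xh.1) (saZ _ _ xh.1); congr (_ - _).
    by apply/esym/eqP; rewrite subr_eq addrC -subr_eq kj.
  rewrite jk !scalerBr !scalerA -!rmorphM [M * g]mulrC; set b := g *r j v.
  by rewrite [in RHS]opprB !addrA subrK addrAC.
(* The positive product is [M] times [g - M^-1 - x], so its constant is divided by [M]. *)
apply: pos_bnd => //; exists (c / M); first by rewrite divr_ge0 // ltW.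
move=> v; have -> : (c / M) *r v - ((g - M^-1) *r v - x v) =
    M^-1 *r (c *r v - (M *r (g *r v - x v) - j (g *r v - x v))).
  rewrite jk !scalerBr !scalerA -!rmorphM mulVf ?gt_eqF //.
  by rewrite rmorphB /= scalerBl [M^-1 * c]mulrC mul1r scale1r [_ - M^-1 *r v - _]addrAC.
by rewrite rnZp ?invr_ge0 ?(ltW M0) // mulrAC [M^-1 * _]mulrC ler_wpM2r ?invr_ge0 ?(ltW M0) //.
Qed.

End PositiveOperators.

(** * Positive elements and monotonicity of the norm *)

Section PositiveElements.
Context {R : realType} {AA : cstarAlgType R[i]}.
Implicit Types (a b u v : AA).

Local Notation "c *r v" := (c%:C%C *: v) (at level 40).

(* If rn a - a had norm g > rn a, invertibility of (g - rn a) + a would improve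
   the bound g. *)
Lemma cpositive_bnd a : cpositive a -> bnd (fun v => rn a *r v - cmul a v) (rn a).
Proof.
move=> [aa asp]; set m := rn a; have m0 : 0 <= m := rn_ge0 a.
pose x v := m *r v - cmul a v; rewrite -/x.
have ah := hop_cmul aa.
have xh : hop x := hop_sub m ah.
have xp : pos x by exists m => // v; rewrite subKr; exact: rn_cmul.
pose S := [set g : R | m <= g /\ bnd x g].
have S2 : S (2 * m).
  split; first by lra.
  move=> v; apply: le_trans (rnB _ _) _; rewrite rnZp //.
  by have := rn_cmul a v; rewrite -/m; lra.
have Slb : lbound S m by move=> g [].
have Si : has_inf S by split; [exists (2 * m) | exists m].
pose g0 := inf S.
have mg : m <= g0 by apply: lb_le_inf => //; exists (2 * m).
have xg : bnd x g0.
  move=> v; have := rn_ge0 v; rewrite le_eqVlt => /orP[/eqP v0|v0].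
    by have [_ /(_ v)] := S2; rewrite -v0 !mulr0.
  rewrite -ler_pdivrMr //; apply: lb_le_inf; first by exists (2 * m).
  by move=> g [_ /(_ v) h]; rewrite ler_pdivrMr.
suff -> : m = g0 by [].
apply/le_anti; rewrite mg /= leNgt; apply/negP => lt_mg.
pose s := g0 - m; have s0 : 0 < s by rewrite subr_gt0.
have sC : (- s)%:C%C != 0 :> R[i].
  by apply/eqP => -[] /eqP; rewrite oppr_eq0 gt_eqF.
pose t := (- s)%:C%C^-1 *: a.
have at_ : a = - (s *r t).
  by rewrite /t -scaleNr -rmorphN scalerA divff ?scale1r.
(* The negative number [- s] is outside the spectrum of [a]. In the unitization [1 - b] inverts
   [1 - t], hence [j] below inverts [g0 - x], which is [s + a]. *)
have [b [tb bt]] : quasi_invertible t.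
  apply: contrapT => nq.
  have /asp : nz_spectrum a (- s)%:C%C.
    by [].
  by rewrite lecR oppr_ge0 leNgt s0.
have tbE : cmul t b = t + b by apply/esym/subr0_eq.
have btE : cmul b t = t + b by apply/esym/subr0_eq.
(* [M] bounds [j], and [M^-1 <= s] keeps [g0 - M^-1] above [m], hence inside [S]. *)
pose M := (1 + rn b) / s.
have b1 : 0 < 1 + rn b by rewrite ltr_pwDl ?rn_ge0.
have M0 : 0 < M by rewrite divr_gt0.
have Ms : M^-1 <= s.
  by rewrite invf_div ler_pdivrMr // ler_peMr ?lerDl ?rn_ge0 // ltW.
pose j v := s^-1 *r (v - cmul b v).
have gm v : g0 *r v - x v = s *r (v - cmul t v).
  by rewrite /x opprB addrCA addrC -scalerBl -rmorphB -/s at_ cmulNl cmulZl -scalerBr.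
have : S (g0 - M^-1).
  split; first by move: Ms; rewrite /s; lra.
  apply: (@bnd_improve _ _ x j) => //.
  - by move: Ms; rewrite /s; lra.
  - move=> v; rewrite /j rnZp ?invr_ge0 ?(ltW s0) // mulrC mulrAC.
    rewrite ler_wpM2r ?invr_ge0 ?(ltW s0) //; apply: le_trans (rnB _ _) _.
    by have := rn_cmul b v; lra.
  - move=> v; rewrite gm /j cmulZr -scalerBr scalerA -rmorphM divff ?gt_eqF //.
    by rewrite rmorph1 scale1r cmulBr cmulA tbE cmulDl opprB [_ + cmul b v]addrC addrK subrK.
  - move=> v; rewrite gm /j cmulZr -scalerBr scalerA -rmorphM mulVf ?gt_eqF //.
    rewrite rmorph1 scale1r cmulBr cmulA btE cmulDl.
    by rewrite opprB addrK subrK.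
move=> /(ge_inf (ex_intro _ m Slb)); rewrite -/g0.
by have : 0 < M^-1 by [rewrite invr_gt0]; lra.
Qed.

(** Positivity read off the multiplication operator: sums then only require adding constants, with
    no spectrum involved. *)
Definition apos a := cstar a = a /\ pos (cmul a).

Lemma cpositive_apos a : cpositive a -> apos a.
Proof.
move=> ap; split; first by case: ap.
by exists (rn a); [exact: rn_ge0 | exact: cpositive_bnd].
Qed.

Lemma aposD a b : apos a -> apos b -> apos (a + b).
Proof.
move=> [aa [c c0 ac]] [bb [d d0 bd]]; split; first by rewrite cstarD aa bb.
exists (c + d); first exact: addr_ge0.
move=> v; rewrite cmulDl rmorphD /= scalerDl opprD addrACA.
by apply: le_trans (rnD _ _) _; rewrite mulrDl lerD.
Qed.

Lemma aposZ (k : R) a : 0 <= k -> apos a -> apos (k *r a).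
Proof.
move=> k0 [aa [c c0 ac]]; split; first by rewrite cstarZr aa.
exists (k * c); first exact: mulr_ge0.
move=> v; rewrite cmulZl rmorphM /= -scalerA -scalerBr rnZp // -mulrA.
exact: ler_wpM2l.
Qed.

(** As operators [0 <= a <= rn (a + b)], so [pos_bnd] bounds multiplication by [a]; evaluating at
    [a] itself gives the norm. *)
Lemma apos_le_rn a b : apos a -> apos b -> rn a <= rn (a + b).
Proof.
move=> [aa ap] [bb [d d0 bd]]; set e := rn (a + b).
have : bnd (cmul a) e.
  apply: pos_bnd (rn_ge0 _) _ => //; first exact: hop_cmul.
  exists (d + e) => [|v]; first by rewrite addr_ge0 // rn_ge0.
  have -> : (d + e) *r v - (e *r v - cmul a v) =
      (d *r v - cmul b v) + cmul (a + b) v.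
    by rewrite rmorphD /= scalerDl opprB addrA addrAC addrK cmulDl [cmul a v + _]addrC addrA subrK.
  apply: le_trans (rnD _ _) _; rewrite mulrDl lerD //; exact: rn_cmul.
have := rn_ge0 a; rewrite le_eqVlt => /orP[/eqP <- _|a0 /(_ a)]; first exact: rn_ge0.
by rewrite -{1}aa rn_starM expr2 ler_pM2r.
Qed.

End PositiveElements.

(** * Operators on Hilbert modules *)

Section HilbertModules.
Context {R : realType} {AA : cstarAlgType R[i]}.
Implicit Types H K : hilbertModType AA.

Local Notation "c *r v" := (c%:C%C *: v) (at level 40).
Local Notation "{< x , y >}" := (inner x y : AA) (at level 0).

Lemma rn_inner_self H (x : H) : rn {<x, x>} = rn x ^+ 2.
Proof. by apply: complexI; rewrite rmorphXn /= -!rnE inner_norm. Qed.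

Lemma adjopE H K (T : 'L(H, K)) x y : {<y, T x>} = {<T^# y, x>}.
Proof. by rewrite -inner_star adjop_axiom inner_star. Qed.

Lemma opD H K (T : 'L(H, K)) x y : T (x + y) = T x + T y.
Proof. by apply: inner_inj => z; rewrite innerDr !adjopE innerDr. Qed.

Lemma opZ H K (T : 'L(H, K)) (l : R[i]) x : T (l *: x) = l *: T x.
Proof. by apply: inner_inj => z; rewrite innerZr !adjopE innerZr. Qed.

Lemma opN H K (T : 'L(H, K)) x : T (- x) = - T x.
Proof. by rewrite -scaleN1r opZ scaleN1r. Qed.

Lemma opB H K (T : 'L(H, K)) x y : T (x - y) = T x - T y.
Proof. by rewrite opD opN. Qed.

Lemma op0 H K (T : 'L(H, K)) : T 0 = 0.
Proof. by rewrite -(subrr 0) opB subrr. Qed.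

Lemma innerBr H (x y z : H) : {<x, y - z>} = {<x, y>} - {<x, z>}.
Proof. by rewrite innerDr innerNr. Qed.

Lemma innerBl H (x y z : H) : {<y - z, x>} = {<y, x>} - {<z, x>}.
Proof. by rewrite innerDl innerNl. Qed.

Lemma innerZlr H (c : R) (x y : H) : {<c *r x, y>} = c *r {<x, y>}.
Proof. by rewrite innerZl conj_Creal //; apply/complex_realP; exists c. Qed.

(** Polarization: four times the inner product is a combination of [q l] over the fourth roots of
    unity [l]. *)
Lemma rn_inner_sqr H (x y : H) : rn {<x, y>} <= (rn x + rn y) ^+ 2.
Proof.
pose q (l : R[i]) := {<x + l *: y, x + l *: y>}.
have qE l : q l = {<x, x>} + l *: {<x, y>} + (l^* *: {<y, x>} + (l^* * l) *: {<y, y>}).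
  by rewrite /q innerDl !innerDr !innerZl !innerZr scalerA.
have qb l : `|l| = 1 -> rn (q l) <= (rn x + rn y) ^+ 2.
  move=> l1; rewrite rn_inner_self lerXn2r ?nnegrE ?addr_ge0 ?rn_ge0 //.
  by apply: le_trans (rnD _ _) _; rewrite rnZ l1 mul1r.
have qD l : q l - q (- l) = 2 *: (l *: {<x, y>} + l^* *: {<y, x>}).
  apply/eqP; rewrite subr_eq; apply/eqP; rewrite !qE rmorphN mulrNN !scaleNr.
  set a := l *: _; set b := l^* *: _; set c := _ *: {<y, y>}; set X := {<x, x>}.
  rewrite scaler_nat mulr2n -[RHS]addrA [(a + b) + (X - a + _)]addrACA.
  rewrite [a + (X - a)]addrC subrK addNKr.
  by rewrite [X + a]addrC addrACA.
have E : 4 *r {<x, y>} = (q 1 - q (- 1)) - 'i *: (q 'i - q (- 'i)).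
  rewrite !qD !scalerDr !scalerA opprD addrACA -!scalerBl conjC1 conjCi.
  rewrite mulr1 -mulrA mulrN !mulrN ![_ * (2 * _)]mulrCA !mulCii mulrN1 !opprK subrr scale0r addr0.
  by rewrite -natrD rmorph_nat.
have := rnD (q 1 - q (- 1)) (- ('i *: (q 'i - q (- 'i)))).
rewrite -E rnZp // rnN rnZ normCi /= mul1r.
have := rnB (q 1) (q (- 1)); have := rnB (q 'i) (q (- 'i)).
have := qb 1; have := qb (- 1); have := qb 'i; have := qb (- 'i).
rewrite !normrN !normr1 !normCi => /(_ erefl) h1 /(_ erefl) h2 /(_ erefl) h3 /(_ erefl) h4.
by move: h1 h2 h3 h4; lra.
Qed.

(** Cauchy-Schwarz up to a constant: rescale [x] and [y] to equal norms in [rn_inner_sqr]. *)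
Lemma rn_inner H (x y : H) : rn {<x, y>} <= 4 * rn x * rn y.
Proof.
have [/rn_eq0 ->|x0] := eqVneq (rn x) 0; first by rewrite inner0l !rn0 mulr0 mul0r.
have [/rn_eq0 ->|y0] := eqVneq (rn y) 0; first by rewrite inner0r !rn0 mulr0.
have p0 : 0 < rn x * rn y by rewrite mulr_gt0 // lt_def ?x0 ?y0 rn_ge0.
have := rn_inner_sqr (rn y *r x) (rn x *r y).
rewrite innerZlr innerZr !rnZp ?rn_ge0 // expr2 => h.
by rewrite -(ler_pM2l p0); move: h; lra.
Qed.

Lemma adj_bound H K (T : 'L(H, K)) k : 0 <= k ->
  (forall x, rn (T^# x) <= k * rn x) -> forall x, rn (T x) <= 4 * k * rn x.
Proof.
move=> k0 Tk x; have := rn_ge0 (T x).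
rewrite le_eqVlt => /orP[/eqP <-|T0]; first by rewrite !mulr_ge0 ?rn_ge0.
rewrite -(ler_pM2r T0) -expr2 -rn_inner_self adjop_axiom.
apply: le_trans (rn_inner _ _) _.
have := ler_wpM2l (mulr_ge0 (ler0n R 4) (rn_ge0 x)) (Tk (T x)); lra.
Qed.

(* Gliding hump: were T unbounded, the series of the q^n y_n with suitable signs,
   y_n being T (x n) normalized, would converge to a point l at which
   <T (x n), l> = <x n, T^# l> is too large. *)
Lemma adjop_bounded H K (T : 'L(H, K)) :
  exists2 k, 0 <= k & forall x, rn (T x) <= k * rn x.
Proof.
apply: contrapT => nb.
have /boolp.choice[x xP] : forall n : nat, exists x, 16 ^+ n * n.+1%:R * rn x < rn (T x).
  move=> n; apply: contrapT => nx; apply: nb.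
  exists (16 ^+ n * n.+1%:R) => [|x]; first by rewrite mulr_ge0 ?exprn_ge0 ?ler0n.
  by rewrite leNgt; apply/negP => ?; apply: nx; exists x.
pose t n := rn (T (x n)); pose phi n y := {<T (x n), y>}.
have t0 n : 0 < t n.
  by apply: le_lt_trans (xP n); rewrite !mulr_ge0 ?exprn_ge0 ?ler0n ?rn_ge0.
(* With ratio 1/16, the tail after step [n] contributes at most 4/15 of [q ^+ n * t n], even with
   the factor 4 of [rn_inner]. *)
pose q : R := 16^-1; have q01 : 0 <= q < 1 by rewrite /q; lra.
pose d n := (q ^+ n / t n) *r T (x n).
have dn n : rn (d n) = q ^+ n.
  rewrite /d rnZp ?divfK ?gt_eqF // divr_ge0 ?exprn_ge0 ?(ltW (t0 n)) //.
  by case/andP: q01.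
have phid n : rn (phi n (d n)) = q ^+ n * t n.
  rewrite /phi innerZr rnZp ?rn_inner_self; last first.
    by rewrite divr_ge0 ?exprn_ge0 ?(ltW (t0 n)) //; case/andP: q01.
  by rewrite -/(t n) expr2 mulrA divfK ?gt_eqF.
(* One of the two signs always works: the values of [phi k] at [y + d k] and [y - d k] differ by
   twice [phi k (d k)], whose norm is [q ^+ k * t k]. *)
pose z n := iteri n (fun k y =>
  if q ^+ k * t k <= rn (phi k (y + d k)) then y + d k else y - d k) 0.
have zS n : z n.+1 = if q ^+ n * t n <= rn (phi n (z n + d n)) then z n + d n else z n - d n by [].
have zd n : rn (z n.+1 - z n) = q ^+ n.
  by rewrite zS; case: ifP => _; rewrite addrC addKr ?rnN dn.
have zphi n : q ^+ n * t n <= rn (phi n (z n.+1)).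
  rewrite zS; case: ifPn => // /negbTE; rewrite leNgt => /negbFE h.
  have := rnB (phi n (z n + d n)) (phi n (z n - d n)).
  rewrite -innerBr opprB addrCA addrAC subrr add0r.
  have -> : d n + d n = 2 *r d n by rewrite rmorphD /= scalerDl scale1r.
  rewrite innerZr rnZp ?ler0n // phid; move: h; lra.
have [|l lP] := @geometric_cvg R K z (16 / 15) q q01.
  by move=> n; rewrite zd exprS /q; lra.
have [n nl] : exists n, 60 * rn (T^# l) < n%:R.
  by eexists; apply: archi_boundP; rewrite mulr_ge0 ?rn_ge0.
have h1 : rn (phi n l) <= 4 * rn (x n) * rn (T^# l).
  by rewrite /phi adjop_axiom rn_inner.
have h2 : rn (phi n (l - z n.+1)) <= 4 / 15 * t n * q ^+ n.
  apply: le_trans (rn_inner _ _) _; have := lP n.+1; rewrite exprS /q.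
  by move=> /(ler_wpM2l (ltW (t0 n))); rewrite /t; lra.
have h3 : q ^+ n * t n <= rn (phi n l) + rn (phi n (l - z n.+1)).
  by apply: le_trans (zphi n) _; apply: le_trans (rnB _ _); rewrite -innerBr subKr.
have h4 : n.+1%:R * rn (x n) < q ^+ n * t n.
  have qn : 0 < q ^+ n by rewrite exprn_gt0 // /q invr_gt0.
  have := xP n; rewrite -(ltr_pM2l qn) !mulrA -exprMn /q mulVf ?pnatr_eq0 //.
  by rewrite expr1n mul1r.
have x0 := rn_ge0 (x n); have nx := ler_wpM2r x0 (ltW nl).
have n0 := mulr_ge0 (ler0n R n) x0.
by move: h1 h2 h3 h4 nx n0 x0; rewrite -[n.+1]addn1 natrD; lra.
Qed.

End HilbertModules.

(** * Coercive positive forms and their inverses *)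

Section PositiveForms.
Context {R : realType} {AA : cstarAlgType R[i]} {H : hilbertModType AA}.
Implicit Types (x y z : H) (T S : 'L(H, H)).

Local Notation "c *r v" := (c%:C%C *: v) (at level 40).
Local Notation "{< x , y >}" := (inner x y : AA) (at level 0).

Definition formpos T := forall x, apos {<x, T x>}.

Definition coercive T := exists2 e : R, 0 < e &
  forall x, e * rn x ^+ 2 <= rn {<x, T x>}.

Lemma apos_inner x : apos {<x, x>}.
Proof. exact/cpositive_apos/inner_positive. Qed.

(** The sesquilinear defect [D] vanishes on the diagonal; polarizing with 1 and ['i] makes it both
    antisymmetric and symmetric. *)
Lemma formpos_sa T : formpos T -> self_adjoint T.
Proof.
move=> Tp; apply: adjopP => y; apply: inner_inj => x; rewrite -adjop_axiom.
pose D x y : AA := {<T x, y>} - {<x, T y>}.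
have D0 u : D u u = 0.
  by rewrite /D -inner_star; have [-> _] := Tp u; rewrite subrr.
have Dr u v w l : D u (v + l *: w) = D u v + l *: D u w.
  by rewrite /D opD opZ !innerDr !innerZr scalerBr opprD addrACA.
have Dl u v w l : D (v + l *: w) u = D v u + l^* *: D w u.
  by rewrite /D opD opZ !innerDl !innerZl scalerBr opprD addrACA.
have DD l u v : D (u + l *: v) (u + l *: v) = l *: D u v + l^* *: D v u.
  by rewrite Dl !Dr !D0 scaler0 add0r addr0.
have h1 : D x y + D y x = 0.
  by have := DD 1 x y; rewrite D0 conjC1 !scale1r.
have h2 : D x y - D y x = 0.
  have := DD 'i x y; rewrite D0 conjCi scaleNr -scalerBr => /esym/eqP.
  by rewrite scaler_eq0 (negbTE (neq0Ci _)) => /eqP.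
apply/subr0_eq/eqP; have : D x y *+ 2 == 0.
  by rewrite mulr2n -{2}[D x y](subrK (D y x)) h2 add0r h1.
by rewrite -scaler_nat scaler_eq0 pnatr_eq0.
Qed.

(* Expand <z, T z> >= 0 at z = x - t T^-1 x with t small. *)
Lemma formpos_coercive T : formpos T -> (forall y, exists x, T x = y) ->
  coercive T.
Proof.
move=> Tp Tsurj; have Ts := formpos_sa Tp.
have /boolp.choice[s sP] := Tsurj.
have sadj x y : {<s x, y>} = {<x, s y>}.
  by rewrite -{1}[y]sP adjopE Ts sP.
have [k k0 sk] := adjop_bounded (AdjOp sadj).
(* Chosen so that [t * rn {<s x, x>} <= rn x ^+ 2]: the quadratic term then costs at most half of
   [2 * t * rn x ^+ 2]. *)
pose t : R := (4 * (k + 1))^-1.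
have k10 : 0 < 4 * (k + 1) by lra.
have t0 : 0 < t by rewrite invr_gt0.
exists t => // x; have := Tp (x - t *r s x).
have -> : {<x - t *r s x, T (x - t *r s x)>} =
    {<x, T x>} + t *r (t *r {<s x, x>}) - (2 * t) *r {<x, x>}.
  have e : {<s x, T x>} = {<x, x>} by rewrite adjopE Ts sP.
  rewrite opB opZ sP innerBl !innerBr !innerZlr !innerZr e.
  rewrite mulr_natl mulr2n rmorphD /= scalerDl.
  set a := t *r {<x, x>}; set b := t *r (t *r _).
  by rewrite opprB opprD !addrA [_ - a + b]addrAC.
move=> h1; have h2 := aposZ (mulr_ge0 (ler0n R 2) (ltW t0)) (apos_inner x).
have := apos_le_rn h2 h1; rewrite addrC subrK.
rewrite rnZp ?mulr_ge0 ?(ltW t0) // rn_inner_self => h3.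
have := rnD {<x, T x>} (t *r (t *r {<s x, x>})).
rewrite !rnZp ?(ltW t0) // => h4.
have := rn_inner (s x) x; have := ler_wpM2r (rn_ge0 x) (sk x) => h5 h6.
have h7 : rn {<s x, x>} <= 4 * (k + 1) * rn x ^+ 2.
  by rewrite expr2; have := mulr_ge0 (rn_ge0 x) (rn_ge0 x); move: h5 h6 => /=; lra.
have : t * rn {<s x, x>} <= rn x ^+ 2 by rewrite /t mulrC ler_pdivrMr // mulrC.
move=> /(ler_wpM2l (ltW t0)).
by move: h3 h4; lra.
Qed.

(* Continuity method along T + s, s >= 0: the forms are uniformly coercive. *)
Lemma coercive_surj T : formpos T -> coercive T -> forall y, exists x, T x = y.
Proof.
move=> Tp [e e0 Te].
pose P (s : R) := forall y, exists x, T x + s *r x = y.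
have low s x : 0 <= s -> e / 4 * rn x <= rn (T x + s *r x).
  move=> s0; have := rn_ge0 x; rewrite le_eqVlt => /orP[/eqP <-|x0].
    by rewrite mulr0 rn_ge0.
  have := apos_le_rn (Tp x) (aposZ s0 (apos_inner x)).
  rewrite -innerZr -innerDr => /(le_trans (Te x))/le_trans/(_ (rn_inner _ _)).
  by move=> h; rewrite -(ler_pM2l x0); move: h; rewrite expr2; lra.
have [k k0 Tk] := adjop_bounded T.
(* Large enough for [T / s0] to be a contraction of ratio 1/2, which starts the continuation. *)
pose s0 := 2 * (k + 1); have s00 : 0 < s0 by rewrite /s0; lra.
have Ps0 : P s0.
  move=> y; pose phi x := s0^-1 *r (y - T x).
  have [||x xP] := @contraction_fixpoint R H phi (2^-1); first by lra.
    move=> x x'; rewrite /phi -scalerBr opprB [_ + (T x' - y)]addrC addrA subrK -opB.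
    rewrite rnZp ?invr_ge0 ?(ltW s00) // mulrC ler_pdivrMr // [rn (x - _)]rn_sub /s0.
    by have := Tk (x' - x); have := rn_ge0 (x' - x); lra.
  exists x; rewrite -{2}xP /phi scalerA -rmorphM divff ?gt_eqF // scale1r.
  by rewrite addrC subrK.
(* By [low] the inverse of [T + s] has Lipschitz constant [4 / e] whatever [s] is, so a move by
   [e / 8] gives a contraction of ratio 1/2. *)
have step s s' : P s -> 0 <= s' <= s -> s - s' <= e / 8 -> P s'.
  move=> Ps /andP[s'0 ss'] d y.
  have s_ge0 := le_trans s'0 ss'.
  have /boolp.choice[g gP] := Ps.
  pose phi x := g (y + (s - s') *r x).
  have [||x xP] := @contraction_fixpoint R H phi (2^-1); first by lra.
    move=> x x'; have := low s (phi x - phi x') s_ge0.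
    rewrite opB scalerBr addrACA -opprD !gP opprD addrACA subrr add0r -scalerBr.
    rewrite rnZp ?subr_ge0 // => h; have := ler_wpM2r (rn_ge0 (x - x')) d.
    have e4 : 0 < e / 4 by rewrite divr_gt0.
    by move=> h'; rewrite -(ler_pM2l e4); move: h h'; lra.
  exists x; have := gP (y + (s - s') *r x); rewrite -/(phi x) xP.
  rewrite rmorphB /= scalerBl [s *r x + _]addrC addrA => /addIr ->.
  by rewrite subrK.
have P0 : P 0.
  have main n : P (Num.max 0 (s0 - n%:R * (e / 8))).
    elim: n => [|n IH]; first by rewrite mul0r subr0 max_r // ltW.
    have e8 : 0 < e / 8 by rewrite divr_gt0.
    move: IH; set m := s0 - n%:R * _; set m' := s0 - _; move=> IH.
    have mm : m - m' = e / 8 by rewrite /m /m' -[n.+1]addn1 natrD; lra.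
    apply: step IH _ _.
      rewrite le_max lexx ge_max !le_max lexx /=; apply/orP; right; move: mm; lra.
    rewrite lerBlDr ge_max addr_ge0 ?le_max ?lexx ?(ltW e8) //= -lerBlDl le_max.
    by apply/orP; right; move: mm; lra.
  have := main (Num.bound (s0 / (e / 8))); rewrite max_l // subr_le0.
  rewrite -ler_pdivrMr ?divr_gt0 //; apply/ltW/archi_boundP.
  by rewrite !divr_ge0 ?ltW // divr_gt0.
by move=> y; have [x <-] := P0 y; exists x; rewrite scale0r addr0.
Qed.

Lemma coercive_inv T : formpos T -> coercive T ->
  exists S, [/\ T ** S = id_op H, S ** T = id_op H & self_adjoint S].
Proof.
move=> Tp Tc; have Ts := formpos_sa Tp.
have /boolp.choice[s sP] := coercive_surj Tp Tc.
have sadj x y : {<s x, y>} = {<x, s y>}.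
  by rewrite -{1}[y]sP adjopE Ts sP.
exists (AdjOp sadj); split; apply: adjopP => //= x.
have [e e0 Te] := Tc; apply/subr0_eq/rn_eq0/eqP; rewrite -sqrf_eq0.
have := Te (s (T x) - x); rewrite opB sP subrr inner0r rn0.
by rewrite pmulr_rle0 // => h; apply/eqP/le_anti; rewrite h sqr_ge0.
Qed.

End PositiveForms.

(** * Weighted Moore-Penrose inverses *)

Section OperatorAlgebra.
Context {R : realType} {AA : cstarAlgType R[i]}.
Implicit Types H K E : hilbertModType AA.

Local Notation "c *r v" := (c%:C%C *: v) (at level 40).
Local Notation "{< x , y >}" := (inner x y : AA) (at level 0).

Lemma saE H (T : 'L(H, H)) : self_adjoint T -> forall x, adjop_adj T x = T x.
Proof. by move=> Ts x; rewrite -{2}Ts. Qed.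

Lemma sa_symm H (T : 'L(H, H)) : self_adjoint T ->
  forall x y, {<T x, y>} = {<x, T y>}.
Proof. by move=> Ts x y; rewrite adjop_axiom saE. Qed.

Lemma symm_sa H (T : 'L(H, H)) : (forall x y, {<T x, y>} = {<x, T y>}) ->
  self_adjoint T.
Proof.
move=> Tsym; apply: adjopP => x; apply: inner_inj => z.
by rewrite -adjop_axiom Tsym.
Qed.

Lemma op_eq H K (S T : 'L(H, K)) : S = T -> forall x, S x = T x.
Proof. by move=> ->. Qed.

Lemma sa_comp_swap H (S T : 'L(H, H)) : self_adjoint S -> self_adjoint T ->
  (forall x, S (T x) = 0) -> forall x, T (S x) = 0.
Proof.
move=> Ss Ts ST x; apply: inner_inj => z.
by rewrite adjopE Ts adjopE Ss ST inner0l inner0r.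
Qed.

Lemma posdef_formpos H (T : 'L(H, H)) : posdef T -> formpos T.
Proof. by move=> [_ Tp _] x; apply: cpositive_apos; exact: Tp. Qed.

Lemma posdef_coercive H (T : 'L(H, H)) : posdef T -> coercive T.
Proof.
move=> Tpd; apply: formpos_coercive; first exact: posdef_formpos.
by have [_ _ [S [_ SP]]] := Tpd => y; exists (S y); have [] := SP y.
Qed.

Lemma formpos_conj H K (V : 'L(K, K)) (A : 'L(H, K)) :
  formpos V -> formpos (A^# ** V ** A).
Proof. by move=> Vp x; rewrite /= -adjop_axiom; exact: Vp. Qed.

Lemma formposD H (S T : 'L(H, H)) : formpos S -> formpos T -> formpos (S + T).
Proof. by move=> Sp Tp x; rewrite innerDr; exact: aposD. Qed.

Lemma formposZ H (T : 'L(H, H)) (t : R) : 0 <= t -> formpos T -> formpos (t%:C%C *: T).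
Proof. by move=> t0 Tp x; rewrite innerZr; exact: aposZ. Qed.

(** Completing the compression to [T = p V p + (1 - p)] makes it coercive on all of [K]. Since
    [T p = p T = p V p], the inverse of [T] commutes with [p] and inverts [p V p] on the range of
    [p]. *)
Lemma compress_inv K (V p : 'L(K, K)) : formpos V -> coercive V ->
  self_adjoint p -> p ** p = p ->
  exists S : 'L(K, K), [/\ self_adjoint S, forall x, S (p x) = p (S x) &
    forall x, S (p (V (p x))) = p x].
Proof.
move=> Vp [e e0 Ve] ps pp; have ppx := op_eq pp.
pose q := id_op K - p; pose T := p ** V ** p + q.
have psym x y : {<x, p y>} = {<p x, y>} by rewrite adjopE ps.
have qs x y : {<q x, y>} = {<x, q y>}.
  by rewrite /= innerBl innerBr psym.
have qq x : q (q x) = q x by rewrite /= opB [p (p x)]ppx subrr subr0.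
have TE x : {<x, T x>} = {<p x, V (p x)>} + {<q x, q x>}.
  by rewrite -[T x]/(p (V (p x)) + q x) innerDr psym qs qq.
have Tp : formpos T by move=> x; rewrite TE; apply: aposD; [exact: Vp|exact: apos_inner].
have Tc : coercive T.
  exists (2 * (e^-1 + 1))^-1; first by rewrite invr_gt0 mulr_gt0 // ltr_wpDl ?invr_ge0 ?ltW.
  move=> x; rewrite mulrC ler_pdivrMr; last by rewrite mulr_gt0 // ltr_wpDl ?invr_ge0 ?ltW.
  have h1 := apos_le_rn (Vp (p x)) (apos_inner (q x)).
  have h2 := apos_le_rn (apos_inner (q x)) (Vp (p x)).
  rewrite -TE in h1; rewrite addrC -TE rn_inner_self in h2.
  have : e * rn (p x) ^+ 2 <= rn {<x, T x>} by exact: le_trans (Ve _) h1.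
  rewrite mulrC -ler_pdivlMr // => h3.
  have h4 : rn x <= rn (p x) + rn (q x).
    by apply: le_trans (rnD _ _); rewrite /= addrC subrK.
  have h5 : rn x ^+ 2 <= (rn (p x) + rn (q x)) ^+ 2.
    by rewrite lerXn2r ?nnegrE ?addr_ge0 ?rn_ge0.
  have := sqr_ge0 (rn (p x) - rn (q x)); move: h2 h3 h5; rewrite !expr2; lra.
have [S [TS ST Ss]] := coercive_inv Tp Tc.
have {}TS := op_eq TS; have {}ST := op_eq ST.
have Tpx x : T (p x) = p (V (p x)).
  by rewrite /= [p (p x)]ppx subrr addr0.
have pTx x : p (T x) = p (V (p x)).
  by rewrite /= opD opB ![p (p _)]ppx subrr addr0.
exists S; split=> // x; last by rewrite -Tpx [S _]ST.
have := ST (p (S x)); rewrite /= => <-; congr (S _).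
by rewrite -[RHS]/(T (p (S x))) Tpx -pTx [T _]TS.
Qed.

(* With p = A a and f = 1 - a A, the V-orthogonal projection onto the range of A
   is S1 p V, where S1 inverts p V p on R(p); the U-orthogonal projection along
   N(A) is 1 - S2 f U, where S2 inverts f U f on R(f). *)
Lemma wmp_invertible_of_mp H K (A : 'L(H, K)) (V : 'L(K, K)) (U : 'L(H, H)) :
  mp_invertible A -> formpos V -> coercive V -> formpos U -> coercive U ->
  wmp_invertible V U A.
Proof.
move=> [a [AaA aAa Aas aAs]] Vp Vc Up Uc.
have {}AaA := op_eq AaA; have {}aAa := op_eq aAa.
have Vs := formpos_sa Vp; have Us := formpos_sa Up.
pose p := A ** a; pose f := id_op H - a ** A.
have ps : self_adjoint p by apply: adjopP => x; exact: (op_eq Aas).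
have aAs' : self_adjoint (a ** A) by apply: adjopP => x; exact: (op_eq aAs).
have fs : self_adjoint f.
  by apply: adjopP => x /=; congr (_ - _); exact: (op_eq aAs').
have pp : p ** p = p by apply: adjopP => x /=; rewrite [A (a (A _))]AaA.
have Af x : A (f x) = 0 by rewrite /= opB [A (a (A _))]AaA subrr.
have ff : f ** f = f.
  by apply: adjopP => x; rewrite -[LHS]/(f x - a (A (f x))) Af op0 subr0.
have [S1 [S1s S1p S1V]] := compress_inv Vp Vc ps pp.
have [S2 [S2s S2f S2U]] := compress_inv Up Uc fs ff.
pose Pi := S1 ** p ** V; pose e := id_op H - S2 ** f ** U.
have PiA x : Pi (A x) = A x.
  have := S1V (A x); rewrite /= [A (a (A _))]AaA; exact.
have pPi x : p (Pi x) = Pi x.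
  by rewrite /Pi /= -[A (a (S1 _))]/(p (S1 _)) -S1p /= [A (a (A _))]AaA.
have Ae x : A (e x) = A x.
  by rewrite /e /= opB -[_ - a _]/(f (U x)) S2f Af subr0.
have ef x : e (f x) = 0.
  by rewrite -[e _]/(f x - S2 (f (U (f x)))) S2U subrr.
have er x : e (a (A x)) = e x.
  by apply/esym/subr0_eq; rewrite -opB ef.
have ee x : e (e x) = e x.
  by rewrite -[in LHS]er Ae er.
(* Arranged so that [A ** X] is [Pi] and [X ** A] is [e], the two weighted projections. *)
pose X := e ** a ** Pi.
have AX x : A (X x) = Pi x.
  by rewrite /X -[RHS]pPi; exact: Ae.
have XA x : X (A x) = e x.
  by rewrite -[LHS]/(e (a (Pi (A x)))) PiA er.
exists X; split.
- by apply: adjopP => x; rewrite -[LHS]/(A (X (A x))) XA Ae.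
- by apply: adjopP => x; rewrite -[LHS]/(X (A (X x))) XA; exact: ee.
- apply: symm_sa => x y.
  rewrite -[_ x]/(V (A (X x))) -[(_ ** X) y]/(V (A (X y))) !AX.
  rewrite (sa_symm Vs) -[Pi x]/(S1 (p (V x))) -[Pi y]/(S1 (p (V y))).
  by rewrite (sa_symm S1s) (sa_symm ps) (sa_symm Vs) S1p.
- apply: symm_sa => x y.
  rewrite -[_ x]/(U (X (A x))) -[(_ ** A) y]/(U (X (A y))) !XA.
  rewrite (sa_symm Us) -[e x]/(x - S2 (f (U x))) -[e y]/(y - S2 (f (U y))).
  rewrite innerBl [U (y - _)]opB innerBr (sa_symm S2s) (sa_symm fs) (sa_symm Us).
  by rewrite S2f.
Qed.

End OperatorAlgebra.

(** * The common null space of [A] and [B] *)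

Section Omega.
Context {R : realType} {AA : cstarAlgType R[i]} {H K E : hilbertModType AA}.
Context (A : 'L(H, K)) (B : 'L(H, E)).

Local Notation "c *r v" := (c%:C%C *: v) (at level 40).
Local Notation "{< x , y >}" := (inner x y : AA) (at level 0).
Local Notation G0 := (A^# ** A + B^# ** B).

(** Two positive elements with sum 0 both vanish, by monotonicity of the norm; coercivity of [V] and
    [W] then applies. *)
Lemma weighted_gram_eq0 (V : 'L(K, K)) (W : 'L(E, E)) (s t : R) x :
  formpos V -> coercive V -> formpos W -> coercive W -> 0 < s -> 0 < t ->
  (s%:C%C *: (A^# ** V ** A) + t%:C%C *: (B^# ** W ** B)) x = 0 ->
  A x = 0 /\ B x = 0.
Proof.
move=> Vp [e e0 Ve] Wp [d d0 We] s0 t0 Gx.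
have Ex : s *r {<A x, V (A x)>} + t *r {<B x, W (B x)>} = 0.
  by rewrite [{<A x, _>}]adjop_axiom [{<B x, _>}]adjop_axiom -!innerZr -innerDr -(inner0r x) -Gx.
have sV := aposZ (ltW s0) (Vp (A x)); have tW := aposZ (ltW t0) (Wp (B x)).
have h1 := apos_le_rn sV tW; have h2 := apos_le_rn tW sV.
rewrite Ex rn0 (rnZp _ (ltW s0)) in h1; rewrite addrC Ex rn0 (rnZp _ (ltW t0)) in h2.
split; apply/rn_eq0/eqP; rewrite -sqrf_eq0; apply/eqP/le_anti; rewrite sqr_ge0 andbT.
  rewrite -(pmulr_rle0 _ e0); apply: le_trans (Ve _) _.
  by rewrite -(pmulr_rle0 _ s0).
rewrite -(pmulr_rle0 _ d0); apply: le_trans (We _) _.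
by rewrite -(pmulr_rle0 _ t0).
Qed.

Lemma id_op_formpos (F : hilbertModType AA) : formpos (id_op F).
Proof. exact: apos_inner. Qed.

Lemma id_op_coercive (F : hilbertModType AA) : coercive (id_op F).
Proof. by exists 1 => // x; rewrite mul1r rn_inner_self. Qed.

Lemma gram_eq0 x : G0 x = 0 -> A x = 0 /\ B x = 0.
Proof.
move=> Gx; apply: (@weighted_gram_eq0 (id_op K) (id_op E) 1 1) => //;
  rewrite ?rmorph1 ?scale1r //; try exact: id_op_formpos; try exact: id_op_coercive.
Qed.

Section Projection.
Context (P : 'L(H, H)) (Pproj : is_projection (Defs.kernel A `&` Defs.kernel B) P).

Lemma kerproj_sa : self_adjoint P.
Proof. by have [] := Pproj. Qed.

Lemma kerproj_mem x : A (P x) = 0 /\ B (P x) = 0.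
Proof.
have [_ _ Pr] := Pproj; have : range P (P x) by exists x.
by rewrite Pr => -[].
Qed.

Lemma kerproj_id x : A x = 0 -> B x = 0 -> P x = x.
Proof.
move=> Ax Bx; have [PP _ Pr] := Pproj.
have [y _ <-] : range P x by rewrite Pr.
exact: (op_eq PP).
Qed.

(** If [Z] is the Moore-Penrose inverse, [Z ** G0] is the projection [1 - P]; its adjoint puts the
    range of [1 - P] inside that of [G0]. *)
Lemma kerproj_compl : mp_invertible G0 ->
  exists Z Z' : 'L(H, H), forall x, x - P x = Z (G0 x) /\ x - P x = G0 (Z' x).
Proof.
move=> [Z [GZG _ _ ZGs]]; exists Z, (Z^#) => x.
have {}GZG := op_eq GZG.
have ZGs' : self_adjoint (Z ** G0) by apply: adjopP => z; exact: (op_eq ZGs).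
have PZG : P (Z (G0 x)) = 0.
  apply: (sa_comp_swap ZGs' kerproj_sa) => z.
  have [Az Bz] := kerproj_mem z; rewrite -[LHS]/(Z (A^# (A (P z)) + B^# (B (P z)))).
  by rewrite Az Bz !op0 addr0 op0.
have : G0 (x - Z (G0 x)) = 0 by rewrite opB [G0 (Z _)]GZG subrr.
move=> /gram_eq0[Ay By]; have := kerproj_id Ay By.
rewrite opB PZG subr0 => ->; rewrite subKr; split=> //.
by rewrite -[LHS](op_eq ZGs').
Qed.

(** Makes the invertibility of [G0] quantitative: [x - P x] is [Z (A^# (A x)) + Z (B^# (B x))], with
    bounded coefficients. The 3 comes from squaring a sum of three terms. *)
Lemma kerproj_bound : mp_invertible G0 -> exists2 k : R, 0 < k &
  forall x, rn x ^+ 2 <= k * (rn (P x) ^+ 2 + rn (A x) ^+ 2 + rn (B x) ^+ 2).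
Proof.
move=> /kerproj_compl[Z [Z1 ZP]].
have [k k0 kP] := adjop_bounded (Z ** A^#); have [l l0 lP] := adjop_bounded (Z ** B^#).
exists (3 * (1 + k ^+ 2 + l ^+ 2)).
  by have := sqr_ge0 k; have := sqr_ge0 l; lra.
move=> x; have : rn x <= rn (P x) + k * rn (A x) + l * rn (B x).
  have xE : x = P x + (Z (A^# (A x)) + Z (B^# (B x))).
    by rewrite -opD -[_ + B^# _]/(G0 x) -(proj1 (ZP x)) addrC subrK.
  rewrite {1}xE -addrA; apply: le_trans (rnD _ _) _; rewrite lerD2l.
  by apply: le_trans (rnD _ _) _; apply: lerD; [exact: kP | exact: lP].
set a := rn (P x); set b := rn (A x); set c := rn (B x) => h.
have h2 : rn x ^+ 2 <= (a + k * b + l * c) ^+ 2.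
  by rewrite lerXn2r ?nnegrE ?rn_ge0 // !addr_ge0 ?mulr_ge0 ?rn_ge0.
apply: le_trans h2 _.
have := sqr_ge0 (a - k * b); have := sqr_ge0 (a - l * c).
have := sqr_ge0 (k * b - l * c).
have := sqr_ge0 (k * a); have := sqr_ge0 (k * c); have := sqr_ge0 (l * a).
have := sqr_ge0 (l * b); have := sqr_ge0 a; have := sqr_ge0 b; have := sqr_ge0 c.
rewrite !expr2; lra.
Qed.

End Projection.

End Omega.

(** * Weights in [Omega] and invertibility of the regularized operators *)

Section OmegaStructure.
Context {R : realType} {AA : cstarAlgType R[i]} {H K E : hilbertModType AA}.
Context (A : 'L(H, K)) (B : 'L(H, E)).

Local Notation "c *r v" := (c%:C%C *: v) (at level 40).
Local Notation "{< x , y >}" := (inner x y : AA) (at level 0).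
Local Notation G0 := (A^# ** A + B^# ** B).
Local Notation kerAB := (Defs.kernel A `&` Defs.kernel B).

(** [U] is block diagonal for the decomposition given by [P]: its blocks are [U1] on the range of
    [G0] and [Y] on the common null space. Both are positive and invertible, hence so is [U]. *)
Lemma Omega_structure (W : 'L(E, E)) (U : 'L(H, H)) :
  mp_invertible G0 -> Omega A B W U ->
  exists (X : 'L(K, K)) (P : 'L(H, H)),
  [/\ self_adjoint X, is_projection kerAB P, formpos U /\ coercive U,
      forall x, P x = 0 -> U x = A^# (X (A x)) + B^# (W (B x)) &
      forall e : 'L(H, H), self_adjoint (U ** e) -> (forall x, e (P x) = 0) ->
        forall x, P (e x) = 0].
Proof.
move=> G0mp [X [Y [P [Xs [[U1' [U1D _ U1adj]] U1p [S1 [[S1' [S1D _ _]] S1P]]]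
  [[Y' [YD Y'D Yadj]] Yp [S2 [[S2' [S2D _ _]] S2P]]] Pproj UE]]]].
have Ps := kerproj_sa Pproj.
have [PP _ Pr] := Pproj; have {}PP x : P (P x) = P x := op_eq PP x.
have PN x : kerAB (P x) by rewrite -Pr; exists x.
have NP x : kerAB x -> P x = x by move=> [? ?]; exact: (kerproj_id Pproj).
have [Z0 [Z ZP]] := kerproj_compl Pproj G0mp.
pose D := range G0.
have De x : D (x - P x) by exists (Z x) => //; have [_ ->] := ZP x.
have G0P x : G0 (P x) = 0.
  rewrite -[LHS]/(A^# (A (P x)) + B^# (B (P x))).
  by have [-> ->] := kerproj_mem Pproj x; rewrite !op0 addr0.
have PD x : D x -> P x = 0.
  move=> [y _ <-]; apply: (sa_comp_swap _ Ps) => //; exact: adjopP.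
pose U1 := A^# ** X ** A + B^# ** W ** B; rewrite -/U1 in UE U1D U1adj U1p S1P.
have U1P x : kerAB x -> U1 x = 0.
  move=> [Ax Bx]; rewrite -[LHS]/(A^# (X (A x)) + B^# (W (B x))).
  by rewrite Ax Bx !op0 addr0.
have N0 : kerAB 0 by split; exact: op0.
(* [Y] is a bare function, known only through its adjoint on the submodule, so even this is derived
   from the adjoint relation. *)
have Y0 : Y 0 = 0.
  by apply: inner_eq0; rewrite (Yadj _ _ N0 (YD _ N0)) inner0l.
have Yinj x : kerAB x -> Y x = 0 -> x = 0.
  by move=> Nx Yx; have [_ <-] := S2P x Nx; have [_] := S2P 0 N0; rewrite Yx Y0.
have Up : formpos U.
  move=> x; rewrite UE innerDr; apply: aposD; apply/cpositive_apos.
    have -> : U1 x = U1 (x - P x) by rewrite opB (U1P _ (PN x)) subr0.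
    have -> : {<x, U1 (x - P x)>} = {<x - P x, U1 (x - P x)>}.
      by rewrite innerBl (sa_symm Ps) (PD _ (U1D _ (De x))) inner0r subr0.
    exact: U1p (De x).
  have -> : {<x, Y (P x)>} = {<P x, Y (P x)>}.
    by rewrite -(NP _ (YD _ (PN x))) -(sa_symm Ps) (NP _ (YD _ (PN x))).
  exact: Yp (PN x).
exists X, P; split=> //.
- split=> //; apply: formpos_coercive => // y.
  have Dy := S1D _ (De y); have Ny := S2D _ (PN y).
  exists (S1 (y - P y) + S2 (P y)); rewrite UE !opD (U1P _ Ny) addr0.
  have [-> _] := S1P _ (De y); rewrite (PD _ Dy) add0r (NP _ Ny).
  by have [-> _] := S2P _ (PN y); rewrite subrK.
- by move=> x Px; rewrite UE Px Y0 addr0.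
(* Taking adjoints in [U e P = 0] gives [P U e = 0]; the [P]-component of [U (e x)] is
   [Y (P (e x))], and [Y] is injective. *)
- move=> e Ues eP x; apply: Yinj; first exact: PN.
  have : P (U (e x)) = 0 by apply: (sa_comp_swap Ues Ps) => z; rewrite /= eP op0.
  rewrite UE opD [U1 _](_ : _ = U1 (e x - P (e x))); last first.
    by rewrite opB (U1P _ (PN _)) subr0.
  by rewrite (PD _ (U1D _ (De _))) add0r (NP _ (YD _ (PN _))).
Qed.

(** Adding [P] fills the null space of [G]: the sum [N] is coercive by [kerproj_bound]. If [S]
    inverts it, [S - P] is the Moore-Penrose inverse, both products with [G] being [1 - P]. *)
Lemma regularized_mp_invertible (V : 'L(K, K)) (W : 'L(E, E)) (P : 'L(H, H))
    (t : R) : mp_invertible G0 -> is_projection kerAB P ->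
  formpos V -> coercive V -> formpos W -> coercive W -> 0 < t ->
  mp_invertible (A^# ** V ** A + t%:C%C *: (B^# ** W ** B)).
Proof.
move=> G0mp Pproj Vp [e e0 Ve] Wp [d d0 We] t0.
set G := A^# ** V ** A + _.
have Ps := kerproj_sa Pproj; have [PP _ _] := Pproj; have {}PP x : P (P x) = P x := op_eq PP x.
have [k k0 kP] := kerproj_bound Pproj G0mp.
have Gp : formpos G.
  by apply: formposD; [|apply: formposZ (ltW t0) _]; exact: formpos_conj.
have Gs := formpos_sa Gp.
have Pp : formpos P by move=> x; rewrite -PP -(sa_symm Ps); exact: apos_inner.
pose N := G + P.
have Np : formpos N by exact: formposD.
have NE x : {<x, N x>} = {<A x, V (A x)>} + t *r {<B x, W (B x)>} + {<P x, P x>}.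
  rewrite [{<A x, _>}]adjop_axiom [{<B x, _>}]adjop_axiom (sa_symm Ps) PP.
  by rewrite -innerZr -!innerDr.
have Nc : coercive N.
  (* The summands account for the [P], [A] and [B] parts. This constant blows up as [t] tends to 0,
     so it cannot serve for the limit. *)
  pose c := k * (1 + e^-1 + (t * d)^-1).
  have c0 : 0 < c.
    have : 0 < e^-1 by rewrite invr_gt0.
    have : 0 < (t * d)^-1 by rewrite invr_gt0 mulr_gt0.
    by move=> ? ?; rewrite mulr_gt0 //; lra.
  exists c^-1; first by rewrite invr_gt0.
  move=> x; rewrite mulrC ler_pdivrMr //; apply: le_trans (kP x) _.
  rewrite mulrC /c mulrA mulrAC ler_wpM2r ?(ltW k0) //.
  have aA := Vp (A x); have aB := aposZ (ltW t0) (Wp (B x)).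
  have aP := apos_inner (P x).
  have h1 := apos_le_rn aP (aposD aA aB).
  have h2 := apos_le_rn aA (aposD aB aP).
  have h3 := apos_le_rn aB (aposD aA aP).
  rewrite addrC -NE rn_inner_self in h1; rewrite addrA -NE in h2.
  rewrite addrCA addrA -NE rnZp ?(ltW t0) // in h3.
  have h4 := le_trans (Ve (A x)) h2; rewrite mulrC -ler_pdivlMr // in h4.
  have := le_trans (ler_wpM2l (ltW t0) (We (B x))) h3.
  rewrite mulrA mulrC -ler_pdivlMr ?mulr_gt0 // => h5.
  by move: h1 h4 h5; lra.
have [S [NS SN Ss]] := coercive_inv Np Nc.
have {}NS := op_eq NS; have {}SN := op_eq SN.
have GP x : G (P x) = 0.
  rewrite -[LHS]/(A^# (V (A (P x))) + t *r B^# (W (B (P x)))).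
  by have [-> ->] := kerproj_mem Pproj x; rewrite !op0 scaler0 addr0.
have PG x : P (G x) = 0 by apply: (sa_comp_swap Gs Ps).
have SP x : S (P x) = P x.
  by rewrite -[in LHS](PP x) -[P (P x)]add0r -(GP x) -[RHS]SN -PP.
have PS x : P (S x) = P x.
  have : P (G (S x) + P (S x)) = P x := congr1 P (NS x).
  by rewrite opD PG add0r PP.
have Qs : self_adjoint (id_op H - P).
  by apply: adjopP => x; rewrite /= (saE Ps).
pose Z := S - P.
have GZ : G ** Z = id_op H - P.
  apply: adjopP => x; rewrite -[LHS]/(G (S x - P x)) opB GP subr0.
  have : G (S x) + P (S x) = x := NS x.
  by rewrite PS => /(canRL (addrK _)).
have ZG : Z ** G = id_op H - P.
  apply: adjopP => x; rewrite -[LHS]/(S (G x) - P (G x)) PG subr0.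
  have : S (G x + P x) = x := SN x.
  by rewrite opD SP => /(canRL (addrK _)).
exists Z; split.
- by rewrite GZ; apply: adjopP => x; rewrite -[LHS]/(G x - P (G x)) PG subr0.
- rewrite ZG; apply: adjopP => x; rewrite -[LHS]/(Z x - P (Z x)).
  by rewrite [P (Z x)]opB PS PP subrr subr0.
- have -> : id_op H ** G ** Z = G ** Z by apply: adjopP => x.
  by rewrite GZ.
- have -> : id_op H ** Z ** G = Z ** G by apply: adjopP => x.
  by rewrite ZG.
Qed.

End OmegaStructure.

(** * The limit as [t] tends to 0 *)

Section Limit.
Context {R : realType} {AA : cstarAlgType R[i]} {H K E : hilbertModType AA}.
Context (A : 'L(H, K)) (B : 'L(H, E)).

Local Notation "c *r v" := (c%:C%C *: v) (at level 40).
Local Notation "{< x , y >}" := (inner x y : AA) (at level 0).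
Local Notation G0 := (A^# ** A + B^# ** B).
Local Notation kerAB := (Defs.kernel A `&` Defs.kernel B).

(** [x - Z (G x)] lies in the null space of [G], so [P] fixes it; [P] also kills it, since [P x = 0]
    and [P Z G = 0]. *)
Lemma mpinv_regularized_id (V : 'L(K, K)) (W : 'L(E, E)) (P Z : 'L(H, H)) (t : R) :
  is_projection kerAB P ->
  formpos V -> coercive V -> formpos W -> coercive W -> 0 < t ->
  let G := A^# ** V ** A + t%:C%C *: (B^# ** W ** B) in
  is_wmpinv (id_op H) (id_op H) G Z ->
  forall x, P x = 0 -> Z (G x) = x.
Proof.
move=> Pproj Vp Vc Wp Wc t0 G [GZG _ _ ZGs] x Px.
have Ps := kerproj_sa Pproj.
have ZGs' : self_adjoint (Z ** G) by apply: adjopP => z; exact: (op_eq ZGs).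
have PZG : P (Z (G x)) = 0.
  apply: (sa_comp_swap ZGs' Ps) => z.
  rewrite -[LHS]/(Z (A^# (V (A (P z))) + t *r B^# (W (B (P z))))).
  by have [-> ->] := kerproj_mem Pproj z; rewrite !op0 scaler0 addr0 op0.
have : G (x - Z (G x)) = 0 by rewrite opB [G (Z _)](op_eq GZG) subrr.
rewrite {1}/G -[A^# ** V ** A]scale1r -(rmorph1 (real_complex R)).
move=> /(weighted_gram_eq0 Vp Vc Wp Wc ltr01 t0)[Ay By].
have := kerproj_id Pproj Ay By.
by rewrite opB Px PZG subr0 => /esym/subr0_eq.
Qed.

Lemma regularized_limit_bound (V : 'L(K, K)) (W : 'L(E, E)) (U : 'L(H, H))
    (X : 'L(K, H)) :
  mp_invertible G0 -> formpos V -> coercive V -> formpos W -> coercive W ->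
  Omega A B W U -> is_wmpinv V U A X ->
  exists C t1 : R, [/\ 0 <= C, 0 < t1 & forall t, 0 < t <= t1 -> forall Z,
    is_wmpinv (id_op H) (id_op H) (A^# ** V ** A + t%:C%C *: (B^# ** W ** B)) Z ->
    forall y, rn ((Z ** A^# ** V - X) y) <= t * C * rn y].
Proof.
move=> G0mp Vp Vc Wp Wc UO [AXA XAX VAXs UXAs].
have [X0 [P [X0s Pproj _ UE Pe]]] := Omega_structure G0mp UO.
have {}AXA x : A (X (A x)) = A x by exact: (op_eq AXA).
have {}XAX x : X (A (X x)) = X x by exact: (op_eq XAX).
have Vs := formpos_sa Vp; have Ws := formpos_sa Wp.
pose e := X ** A; pose b := B^# ** W ** B.
have bs : self_adjoint b by apply: adjopP => x; rewrite /= (saE Ws).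
have Ues : self_adjoint (U ** e) by apply: adjopP => x; exact: (op_eq UXAs).
have {Pe} Pe x : P (e x) = 0.
  by apply: Pe => // z; rewrite /e /= (proj1 (kerproj_mem Pproj z)) op0.
have PX x : P (X x) = 0 by rewrite -XAX; exact: Pe.
have beE x : b (e x) = U (e x) - A^# (X0 (A x)).
  by rewrite UE // -[A (e x)]/(A (X (A x))) AXA addrC addKr.
(* By [beE], [b e] is the difference of the self-adjoint operators [U e] and [A^# X0 A], hence
   equals its adjoint [e^# b]. *)
have be x : b (e x) = e^# (b x).
  apply: inner_inj => z.
  rewrite beE innerBr -(sa_symm Ues) -[{<z, A^# _>}]adjop_axiom -(sa_symm X0s).
  rewrite [{<X0 _, _>}]adjopE -innerBl -[A^# (X0 _)]/(A^# (X0 (A z))) -beE.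
  by rewrite (sa_symm bs) adjop_axiom.
have bX x : b (X x) = e^# (b (X x)) by rewrite -be /e /= XAX.
have AVAX x : A^# (V (A (X x))) = A^# (V x).
  apply: inner_inj => z; rewrite -!adjop_axiom -[V (A (X x))]/((V ** A ** X) x).
  rewrite -(sa_symm VAXs) -[(_ ** X) _]/(V (A (X (A z)))) AXA.
  exact: sa_symm.
have [Vi [VVi _ Vis]] := coercive_inv Vp Vc.
pose J := X ** Vi ** X^#; pose D := b ** J.
have AVAJ x : A^# (V (A (J x))) = e^# x.
  rewrite -[J x]/(X (Vi (X^# x))) AVAX [V (Vi _)](op_eq VVi). exact: erefl.
have [j j0 jP] := adjop_bounded J^#; have [d d0 dP] := adjop_bounded D^#.
have [m m0 mP] := adjop_bounded (b ** X).
have d1 : 0 < 2 * (d + 1) by lra.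
(* The threshold ensures [t * d <= 2^-1]. The 8 is the 2 from absorbing the term in [D^#] times the
   4 of [adj_bound]. *)
exists (8 * j * m), (2 * (d + 1))^-1; split; first by rewrite !mulr_ge0.
  by rewrite invr_gt0.
move=> t /andP[t0 tt1] Z ZP.
have ZG := mpinv_regularized_id Pproj Vp Vc Wp Wc t0 ZP.
have ZGX x : Z (A^# (V (A (X x)))) + t *r Z (e^# (b (X x))) = X x.
  rewrite -bX -opZ -opD; exact: ZG (PX x).
pose F := Z ** e^#.
have FJ x : F x = J x - t *r F (D x).
  by have := ZGX (Vi (X^# x)); rewrite AVAJ => /(canRL (addrK _)).
(* In [FJ] the two sides evaluate [F] at different points; after passing to adjoints the same vector
   [F^# y] occurs on both sides and can be absorbed. *)
have Fadj y : F^# y = J^# y - t *r D^# (F^# y).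
  apply: inner_inj => z.
  by rewrite -adjop_axiom FJ innerBl innerZlr innerBr innerZr -!adjop_axiom.
have Fb y : rn (F^# y) <= 2 * j * rn y.
  have : rn (F^# y) <= rn (J^# y) + t * rn (D^# (F^# y)).
    by rewrite {1}Fadj -(rnZp _ (ltW t0)) rnB.
  have := jP y; have := ler_wpM2l (ltW t0) (dP (F^# y)).
  have : t * d <= 2^-1.
    have : t * (2 * (d + 1)) <= 1 by rewrite -ler_pdivlMr // mul1r.
    lra.
  move=> /(ler_wpM2r (rn_ge0 (F^# y))); lra.
have {}Fb := adj_bound (mulr_ge0 (ler0n R 2) j0) Fb.
move=> y; have -> : (Z ** A^# ** V - X) y = - (t *r F ((b ** X) y)).
  have := ZGX y; rewrite AVAX => h.
  rewrite -[LHS]/(Z (A^# (V y)) - X y) -h opprD addrA subrr add0r.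
  by [].
rewrite rnN rnZp ?(ltW t0) // -mulrA ler_wpM2l ?(ltW t0) //.
apply: le_trans (Fb _) _; have := ler_wpM2l j0 (mP y); lra.
Qed.

Lemma opnorm_bound (F F' : hilbertModType AA) (T : 'L(F, F')) (c : R) : 0 <= c ->
  (forall x, rn (T x) <= c * rn x) -> (0 <= opnorm T <= c%:E)%E.
Proof.
move=> c0 Tc; apply/andP; split.
  apply: ereal_sup_ubound; exists 0; first by rewrite /= normr0 ler01.
  by rewrite op0 normr0.
apply: ge_ereal_sup => _ [x /= x1 <-]; rewrite lee_fin; apply: le_trans (Tc x) _.
by rewrite ler_piMr // -lecR -rnE.
Qed.

End Limit.

Theorem theorem3p14 (R : realType) (AA : cstarAlgType R[i])
    (H K E : hilbertModType AA) (A : 'L(H, K)) (B : 'L(H, E)) :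
  mp_invertible A -> mp_invertible (A^# ** A + B^# ** B) ->
  forall (V : 'L(K, K)) (W : 'L(E, E)), posdef V -> posdef W ->
  forall U : 'L(H, H), Omega A B W U ->
  [/\ forall t : R, 0 < t ->
        mp_invertible (A^# ** V ** A + t%:C%C *: (B^# ** W ** B)),
      wmp_invertible V U A &
      (fun t : R =>
         opnorm (mpinv (A^# ** V ** A + t%:C%C *: (B^# ** W ** B)) ** A^# ** V
                 - wmpinv V U A)) @ (0 : R)^'+ --> 0%E].

Proof.
move=> Amp G0mp V W Vpd Wpd U UO.
have Vp := posdef_formpos Vpd; have Vc := posdef_coercive Vpd.
have Wp := posdef_formpos Wpd; have Wc := posdef_coercive Wpd.
have [X0 [P [_ Pproj [Up Uc] _ _]]] := Omega_structure G0mp UO.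
have Gmp (t : R) : 0 < t ->
    mp_invertible (A^# ** V ** A + t%:C%C *: (B^# ** W ** B)).
  exact: regularized_mp_invertible G0mp Pproj Vp Vc Wp Wc.
have Awmp := wmp_invertible_of_mp Amp Vp Vc Up Uc.
split=> //.
(* Existence rules out the default value 0 in [wmpinv]. *)
have wmpP (F F' : hilbertModType AA) (M : 'L(F', F')) (N : 'L(F, F)) (T : 'L(F, F')) :
    wmp_invertible M N T -> is_wmpinv M N T (wmpinv M N T).
  by move=> [Y TY]; rewrite /wmpinv; case: xgetP => [y -> //|/(_ _ TY)].
have [C [t1 [C0 t10 bound]]] := regularized_limit_bound G0mp Vp Vc Wp Wc UO (wmpP _ _ _ _ _ Awmp).
apply: (@squeeze_cvge _ _ _ _ (fun=> 0%E) _ (fun t : R => (t * C)%:E)).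
- near=> t.
  have t0 : 0 < t by near: t; exact: nbhs_right_gt.
  apply: opnorm_bound; first by rewrite mulr_ge0 // ltW.
  apply: bound; last exact/wmpP/Gmp.
  by rewrite t0 /=; near: t; exact: nbhs_right_le.
- exact: cvg_cst.
- have tC : (t * C @[t --> (0 : R)^'+] --> 0 * C).
    by apply: cvgM; [apply: cvg_at_right_filter; exact: cvg_id | exact: cvg_cst].
  rewrite mul0r in tC; apply: (@cvg_EFin _ _ _ _ (fun t : R => (t * C)%:E)) => //.
  exact: nearW.
Unshelve. all: by end_near.
Qed.
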